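(* Let $X_1,X_2$ be completely regular spaces and let $H:\mathfrak C[X_1]\times\mathfrak C[X_2]\to[0,+\infty]$ be proper, radially $1$-homogeneous and lower semicontinuous. Then for every $\mu_i\in\mathcal M_+(X_i)$ with $\mu_i(X_i)>0$, $i=1,2$, $$\mathcal U_H(\mu_1,\mu_2)\le\widehat{\mathcal U}_H(\mu_1,\mu_2).$$ If, in addition, $H$ is radially convex, then $$\mathcal U_H(\mu_1,\mu_2)=\widehat{\mathcal U}_H(\mu_1,\mu_2)$$ and the infimum defining $\widehat{\mathcal U}_H(\mu_1,\mu_2)$ is attained.
   Context: Completely regular spaces are assumed Hausdorff; $\mathcal M_+(X)$ is the set of finite nonnegative Radon measures on $X$. Cone: $\mathfrak C[X]=(X\times[0,+\infty))/\sim$, where $(x,r)\sim(y,s)$ iff ($x=y$ and $r=s\neq0$) or $r=s=0$; $[x,r]$ is the class of $(x,r)$ and $\mathfrak o=[x,0]$ the vertex. A neighbourhood base at $[x,r]$ with $r>0$ is given by the images of the neighbourhoods of $(x,r)$ in the product topology; at $\mathfrak o$ by the sets $\{[x,r]:0\le r<\varepsilon\}$, $\varepsilon>0$. Products of cones have the product topology. $H$ is proper if not identically $+\infty$; radially $1$-homogeneous if $H([x_1,\lambda r_1],[x_2,\lambda r_2])=\lambda H([x_1,r_1],[x_2,r_2])$ for all $\lambda>0$; radially convex if $(r_1,r_2)\mapsto H([x_1,r_1],[x_2,r_2])$ is convex on $[0,+\infty)^2$ for all $(x_1,x_2)$. $\mathcal U_H(\mu_1,\mu_2):=\inf\{\int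 H\,d\alpha:\alpha\in\mathfrak H^1(\mu_1,\mu_2)\}$, where $\mathfrak H^1(\mu_1,\mu_2)$ is the set of nonnegative finite Radon measures $\alpha$ on $\mathfrak C[X_1]\times\mathfrak C[X_2]$ with $\int(r_1+r_2)\,d\alpha<+\infty$ and $\mu_i(A)=\int_{\{r_i>0,\ x_i\in A\}}r_i\,d\alpha([x_1,r_1],[x_2,r_2])$ for every Borel $A\subset X_i$, $i=1,2$. Semi-couplings: $\hat\Gamma(\mu_1,\mu_2)$ is the set of pairs $(\gamma_1,\gamma_2)\in\mathcal M_+(X_1\times X_2)^2$ such that the first marginal of $\gamma_1$ is $\mu_1$ and the second marginal of $\gamma_2$ is $\mu_2$. Set $$J_H(\gamma_1,\gamma_2):=\int_{X_1\times X_2}H\Big(\Big[x_1,\frac{d\gamma_1}{d\gamma}\Big],\Big[x_2,\frac{d\gamma_2}{d\gamma}\Big]\Big)\,d\gamma(x_1,x_2),$$ where $\gamma\in\mathcal M_+(X_1\times X_2)$ is any measure with $\gamma_1\ll\gamma$ and $\gamma_2\ll\gamma$ (by radial $1$-homogeneity the value does not depend on $\gamma$), and $\widehat{\mathcal U}_H(\mu_1,\mu_2):=\inf\{J_H(\gamma_1,\gamma_2):(\gamma_1,\gamma_2)\in\hat\Gamma(\mu_1,\mu_2)\}$. *)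

(* Defs.v *)
From HB Require Import structures.
From mathcomp Require Import all_boot all_order all_algebra.
From mathcomp Require Import generic_quotient lra.
From mathcomp Require Import all_classical all_reals all_analysis.
From mathcomp Require Import measurable_realfun.

Set Implicit Arguments.
Unset Strict Implicit.
Unset Printing Implicit Defensive.

Import Order.TTheory GRing.Theory Num.Theory.
Import numFieldNormedType.Exports.

Local Open Scope classical_set_scope.
Local Open Scope ring_scope.
Local Open Scope quotient_scope.

Definition radii (R : realType) : set R := [set r | 0 <= r].
Arguments radii : clear implicits.

Section cone.
Variables (R : realType) (X : topologicalType).
Local Notation cylinder := (X * radii R)%type.
Implicit Types p q : cylinder.

Definition cone_rel p q : bool :=
  [&& p.1 == q.1, \val p.2 == \val q.2 & \val q.2 != 0]
  || (\val p.2 == 0) && (\val q.2 == 0).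

Lemma cone_rel_refl : reflexive cone_rel.
Proof. by move=> p; rewrite /cone_rel !eqxx /=; case: eqP. Qed.

Lemma cone_rel_sym : symmetric cone_rel.
Proof.
move=> p q; rewrite /cone_rel (eq_sym p.1) (eq_sym (\val p.2) (\val q.2)).
by case: (eqVneq (\val q.2) (\val p.2)) => [->//|_]; rewrite !andbF /= andbC.
Qed.

Lemma cone_rel_trans : transitive cone_rel.
Proof.
move=> q p s; rewrite /cone_rel => /orP[/and3P[/eqP -> /eqP -> _]//|].
move=> /andP[/eqP -> /eqP ->]; rewrite eqxx /= => /orP[|->]; last by rewrite orbT.
by move=> /and3P[_ /eqP <-]; rewrite eqxx.
Qed.

Definition cone_equiv := EquivRel _ cone_rel_refl cone_rel_sym cone_rel_trans.

Definition cone : Type := {eq_quot cone_equiv}.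
HB.instance Definition _ := Quotient.on cone.
HB.instance Definition _ := Choice.on cone.

Definition cone_rad (c : cone) : R := \val (repr c).2.

(* The value at the vertex is arbitrary. *)
Definition cone_base (c : cone) : X := (repr c).1.

Lemma cone_rad_ge0 (c : cone) : 0 <= cone_rad c.
Proof. by have := valP (repr c).2; rewrite inE. Qed.

Lemma cone_rad_pi p : cone_rad (\pi_cone p) = \val p.2.
Proof.
rewrite /cone_rad; have /eqmodP := reprK (\pi_cone p).
by move=> /orP[/and3P[_ /eqP //]|/andP[/eqP -> /eqP ->]].
Qed.

Lemma cone_base_pi p : \val p.2 != 0 -> cone_base (\pi_cone p) = p.1.
Proof.
rewrite /cone_base; have /eqmodP := reprK (\pi_cone p).
by move=> /orP[/and3P[/eqP //]|/andP[_ /eqP ->]]; rewrite eqxx.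
Qed.

Lemma cone_repr_pi p : \val p.2 != 0 -> repr (\pi_cone p) = p.
Proof.
move=> p0; have := cone_base_pi p0; have := cone_rad_pi p.
rewrite /cone_rad /cone_base; case: (repr _) => y s; case: p p0 => x r /= _ rs ->.
by congr pair; exact: val_inj.
Qed.

(* This is not the quotient topology: at the vertex the neighbourhoods are
   uniform in the base point. *)
Definition cone_nbhs (c : cone) : set_system cone :=
  if cone_rad c == 0
  then [set A | exists2 e : R, 0 < e & [set c' | cone_rad c' < e] `<=` A]
  else \pi_cone @ nbhs (repr c).

HB.instance Definition _ := hasNbhs.Build cone cone_nbhs.

Lemma cone_nbhs_filter (c : cone) : ProperFilter (nbhs c).
Proof.
rewrite /nbhs /= /cone_nbhs; case: eqP => [c0|_]; last first.
  exact: fmap_proper_filter.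
split.
  by move=> [e e0 /(_ c)]; rewrite /= c0; exact.
split.
- by exists 1.
- move=> A B [e e0 eA] [f f0 fB]; exists (Num.min e f); first by rewrite lt_min e0.
  by move=> d /=; rewrite lt_min => /andP[? ?]; split; [exact: eA|exact: fB].
- by move=> A B AB [e e0 eA]; exists e => // d /eA /AB.
Qed.

Lemma cone_nbhs_singleton (c : cone) (A : set cone) : nbhs c A -> A c.
Proof.
rewrite /nbhs /= /cone_nbhs; case: eqP => [c0 [e e0]|_]; last first.
  by move=> /= /nbhs_singleton /=; rewrite reprK.
by apply; rewrite /= c0.
Qed.

Lemma continuous_radius : continuous (fun p => \val p.2).
Proof.
move=> p; apply: (@continuous_comp _ _ _ snd (fun r : radii R => \val r)).
  exact: cvg_snd.
exact: initial_continuous.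
Qed.

Lemma cone_nbhs_nbhs (c : cone) (A : set cone) :
  nbhs c A -> nbhs c (nbhs^~ A).
Proof.
rewrite {1 2}/nbhs /= /cone_nbhs; case: eqP => [c0 [e e0 eA]|/eqP c0 /= cA].
  exists e => // d de; rewrite /nbhs /= /cone_nbhs; case: eqP => [d0|_].
    by exists e.
  have : \forall p \near repr d, \val p.2 < e.
    exact: (@continuous_radius (repr d) _ (lt_nbhsl de)).
  by apply: filterS => p pe; apply: eA; rewrite /= cone_rad_pi.
have : \forall p \near repr c, 0 < \val p.2.
  have c1 : 0 < cone_rad c by rewrite lt0r c0 cone_rad_ge0.
  exact: (@continuous_radius (repr c) _ (lt_nbhsr c1)).
have /nbhs_interior := cA.
apply: filterS2 => p /= pA p0.
rewrite /nbhs /= /cone_nbhs cone_rad_pi gt_eqF//= cone_repr_pi ?gt_eqF//.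
Qed.

HB.instance Definition _ := Nbhs_isNbhsTopological.Build cone
  cone_nbhs_filter cone_nbhs_singleton cone_nbhs_nbhs.

Lemma radii_max0 (r : R) : Num.max 0 r \in radii R.
Proof. by rewrite inE /radii /= le_max lexx. Qed.

(* [x, r] is only meaningful for 0 <= r; negative radii give the vertex. *)
Definition cone_pt (x : X) (r : R) : cone :=
  \pi_cone (x, SigSub (radii_max0 r)).

Lemma cone_rad_pt (x : X) (r : R) : cone_rad (cone_pt x r) = Num.max 0 r.
Proof. exact: cone_rad_pi. Qed.

Lemma cone_ptK (c : cone) : cone_pt (cone_base c) (cone_rad c) = c.
Proof.
rewrite -[RHS]reprK /cone_pt; congr \pi_cone.
rewrite [RHS]surjective_pairing; congr pair.
by apply: val_inj => /=; rewrite max_r// cone_rad_ge0.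
Qed.

Lemma cone_pt_vertex (x y : X) (r s : R) : (r <= 0)%R -> (s <= 0)%R ->
  cone_pt x r = cone_pt y s.
Proof.
move=> r0 s0; apply/eqmodP; apply/orP; right => /=.
by rewrite !max_l// eqxx.
Qed.

Lemma cone_pt_max0 (x : X) (r : R) : cone_pt x (Num.max 0 r) = cone_pt x r.
Proof.
rewrite /cone_pt; congr \pi_cone; congr pair.
by apply: val_inj => /=; rewrite maxA maxxx.
Qed.

Lemma continuous_pi : continuous (\pi_cone : cylinder -> cone).
Proof.
move=> p A; rewrite {1}/nbhs /= /cone_nbhs cone_rad_pi; case: eqP => [p0|/eqP p0].
  move=> [e e0 eA].
  have pe : (\val p.2 < e)%R by rewrite p0.
  have := @continuous_radius p _ (lt_nbhsl pe).
  by apply: (@filterS _ (nbhs p)) => q /= qe; apply: eA; rewrite /= cone_rad_pi.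
by rewrite cone_repr_pi.
Qed.

Lemma continuous_cone_pt : continuous (fun p : X * R => cone_pt p.1 p.2).
Proof.
have c2 : continuous (fun p : X * R => SigSub (radii_max0 p.2) : radii R).
  apply: continuous_comp_initial => p.
  apply: (@continuous_comp _ _ _ snd (fun r : R => Num.max 0 r)).
    exact: cvg_snd.
  by apply: continuous_max; [exact: cvg_cst|exact: cvg_id].
move=> p; apply: (@continuous_comp _ _ _
  (fun p : X * R => (p.1, SigSub (radii_max0 p.2)) : cylinder) \pi_cone).
  have := cvg_pair (@cvg_fst _ _ (nbhs p.1) (nbhs p.2) _) (c2 p).
  exact.
exact: continuous_pi.
Qed.

End cone.

HB.instance Definition _ (R : realType) (X : ptopologicalType) :=
  isPointed.Build (cone R X) (cone_pt point 0).

HB.instance Definition _ (X Y : ptopologicalType) :=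
  Pointed.on (X * Y)%type.

(* For T = X * Y this is the Borel sigma-algebra of the product topology, which
   may be larger than the product of the Borel sigma-algebras. *)
Definition borel (T : ptopologicalType) : Type := T.
HB.instance Definition _ (T : ptopologicalType) :=
  Measurable.copy (borel T) (g_sigma_algebraType (@open T)).

(* Used for Hausdorff T, where the compact sets K are Borel. *)
Definition radon (R : realType) (T : ptopologicalType)
    (mu : {finite_measure set (borel T) -> \bar R}) : Prop :=
  forall A : set (borel T), measurable A ->
    mu A = ereal_sup [set mu K | K in [set K : set T | compact K /\ K `<=` A]].

Section borel_measurability.
Context (R : realType) (Z : ptopologicalType).

Lemma open_measurable_borel (A : set Z) : open A -> measurable (A : set (borel Z)).
Proof. exact: sub_sigma_algebra. Qed.

Lemma measurable_graph_open (f g : borel Z -> R) (W : set (Z * (R * R))) :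
  measurable_fun setT f -> measurable_fun setT g -> open W ->
  measurable ([set z | W (z, (f z, g z))] : set (borel Z)).
Proof.
move=> mf mg oW.
pose I (q : rat * rat) : set R := `]ratr q.1, ratr q.2[%classic.
pose U (q : (rat * rat) * (rat * rat)) : set Z :=
  \bigcup_(V in [set V : set Z | open V /\
    forall z r s, V z -> I q.1 r -> I q.2 s -> W (z, (r, s))]) V.
rewrite (_ : mkset _ = \bigcup_q (U q `&` (f @^-1` I q.1 `&` g @^-1` I q.2))).
  apply: countable_bigcupT_measurable => // q.
  apply: measurableI.
    by apply: open_measurable_borel; apply: bigcup_open => V [].
  apply: measurableI; rewrite -[X in measurable X]setTI.
    by apply: mf => //; exact: measurable_itv.
  by apply: mg => //; exact: measurable_itv.
apply/seteqP; split => [z /= Wz|z [q _ [[V [_ VW] Vz] [fz gz]]]]; last exact: VW.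
have /= : nbhs (z, (f z, g z)) W by exact: open_nbhs_nbhs.
move=> [[A B] /= [zA [[C D] /= [fC gD] CDB]] ABW].
have rat_itv (a : R) (E : set R) : nbhs a E -> exists2 q, I q a & I q `<=` E.
  move=> /nbhs_ballP[e /= e0 eE].
  have /rat_in_itvoo[q1 q1a] : (a - e < a)%R by rewrite ltrBlDr ltrDl.
  have /rat_in_itvoo[q2 q2a] : (a < a + e)%R by rewrite ltrDl.
  move: q1a q2a; rewrite !in_itv/= => /andP[q11 q12] /andP[q21 q22].
  exists (q1, q2); first by rewrite /I /= in_itv /= q12.
  move=> b; rewrite /I /= in_itv /= => /andP[b1 b2]; apply: eE.
  rewrite /ball /= ltr_distlC (lt_trans q11)//=.
  by rewrite (lt_trans b2).
have [p pf pC] := rat_itv _ _ fC.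
have [q qg qD] := rat_itv _ _ gD.
exists (p, q) => //; split => //.
exists A^°; last by rewrite /interior.
split; first exact: open_interior.
move=> y r s /interior_subset Ay pr qs; apply: ABW; split => //=.
by apply: CDB; split => /=; [exact: pC|exact: qD].
Qed.

End borel_measurability.

Local Open Scope ereal_scope.
Local Open Scope charge_scope.

Section finite_measure_add.
Context d (T : measurableType d) (R : realType).
Variables m1 m2 : {finite_measure set T -> \bar R}.

Let measure_add_fin : fin_num_fun (measure_add m1 m2).
Proof.
by move=> A mA; rewrite measure_addE fin_numD !fin_num_measure.
Qed.

HB.instance Definition _ := Measure.on (measure_add m1 m2).
HB.instance Definition _ :=
  Measure_isFinite.Build _ _ _ (measure_add m1 m2) measure_add_fin.

End finite_measure_add.

Section transport.
Variables (R : realType) (X1 X2 : ptopologicalType).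
Local Notation fmeasure T := {finite_measure set (borel T%type) -> \bar R}.
Variable H : cone R X1 * cone R X2 -> \bar R.

Definition proper_cost : Prop := exists p, H p != +oo.

Definition radially_homogeneous : Prop :=
  forall (x1 : X1) (x2 : X2) (r1 r2 l : R),
    (0 <= r1)%R -> (0 <= r2)%R -> (0 < l)%R ->
    H (cone_pt x1 (l * r1), cone_pt x2 (l * r2)) =
    l%:E * H (cone_pt x1 r1, cone_pt x2 r2).

(* At t = 0 and t = 1 the product 0 * +oo is 0. *)
Definition radially_convex : Prop :=
  forall (x1 : X1) (x2 : X2) (r1 r2 s1 s2 t : R),
    (0 <= r1)%R -> (0 <= r2)%R -> (0 <= s1)%R -> (0 <= s2)%R ->
    (0 <= t <= 1)%R ->
    H (cone_pt x1 (t * r1 + (1 - t) * s1), cone_pt x2 (t * r2 + (1 - t) * s2))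
    <= t%:E * H (cone_pt x1 r1, cone_pt x2 r2) +
       (1 - t)%:E * H (cone_pt x1 s1, cone_pt x2 s2).

Definition homogeneous_coupling
    (mu1 : fmeasure X1) (mu2 : fmeasure X2)
    (alpha : fmeasure (cone R X1 * cone R X2)) : Prop :=
  [/\ radon alpha,
      \int[alpha]_p (cone_rad p.1 + cone_rad p.2)%:E < +oo,
      forall A : set (borel X1), measurable A ->
        mu1 A =
        \int[alpha]_(p in [set p | (0 < cone_rad p.1)%R /\ A (cone_base p.1)])
          (cone_rad p.1)%:E &
      forall A : set (borel X2), measurable A ->
        mu2 A =
        \int[alpha]_(p in [set p | (0 < cone_rad p.2)%R /\ A (cone_base p.2)])
          (cone_rad p.2)%:E].

Definition transport_cost
    (mu1 : fmeasure X1) (mu2 : fmeasure X2) : \bar R :=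
  ereal_inf [set \int[alpha]_p H p | alpha in homogeneous_coupling mu1 mu2].

Definition semi_coupling
    (mu1 : fmeasure X1) (mu2 : fmeasure X2)
    (gamma : fmeasure (X1 * X2) * fmeasure (X1 * X2)) : Prop :=
  [/\ radon gamma.1, radon gamma.2,
      forall A : set (borel X1), measurable A ->
        gamma.1 (fst @^-1` A) = mu1 A &
      forall A : set (borel X2), measurable A ->
        gamma.2 (snd @^-1` A) = mu2 A].

(* The Radon-Nikodym derivative is finite, and nonnegative almost everywhere,
   when nu `<< gamma. *)
Definition density (nu gamma : fmeasure (X1 * X2)) (p : X1 * X2) : R :=
  fine ('d (charge_of_finite_measure nu) '/d gamma p).

Definition semi_coupling_cost_wrt
    (gamma g1 g2 : fmeasure (X1 * X2)) : \bar R :=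
  \int[gamma]_p H (cone_pt p.1 (density g1 gamma p),
                   cone_pt p.2 (density g2 gamma p)).

(* The choice of g.1 + g.2 as reference measure is immaterial, see
   semi_coupling_cost_wrtE below. *)
Definition semi_coupling_cost
    (g : fmeasure (X1 * X2) * fmeasure (X1 * X2)) : \bar R :=
  semi_coupling_cost_wrt (measure_add g.1 g.2) g.1 g.2.

Definition semi_coupling_transport_cost
    (mu1 : fmeasure X1) (mu2 : fmeasure X2) : \bar R :=
  ereal_inf [set semi_coupling_cost g | g in semi_coupling mu1 mu2].

End transport.

Section reference_measure.
Variables (R : realType) (X1 X2 : ptopologicalType).
Local Notation fmeasure T := {finite_measure set (borel T%type) -> \bar R}.
Variable H : cone R X1 * cone R X2 -> \bar R.
Hypothesis H_ge0 : forall p, 0 <= H p.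
Hypothesis H_lsc : lower_semicontinuous H.

Lemma measurable_cone_cost (f g : borel (X1 * X2)%type -> R) :
  measurable_fun setT f -> measurable_fun setT g ->
  measurable_fun setT ((fun p => H (cone_pt p.1 (f p), cone_pt p.2 (g p)))
    : borel (X1 * X2)%type -> \bar R).
Proof.
move=> mf mg; apply: (measurability _ (ErealGenOInfty.measurableE R)).
move=> _ [_ [a ->] <-]; rewrite setTI preimage_itvoy.
apply: (@measurable_graph_open R (X1 * X2)%type f g
  [set w | a%:E < H (cone_pt w.1.1 w.2.1, cone_pt w.1.2 w.2.2)]) => //.
have /continuousP cg : continuous (fun w : (X1 * X2) * (R * R) =>
   (cone_pt w.1.1 w.2.1, cone_pt w.1.2 w.2.2)).
  move=> w; apply: (@cvg_pair _ _ _ _ (nbhs (cone_pt w.1.1 w.2.1))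
    (nbhs (cone_pt w.1.2 w.2.2))).
    apply: (@continuous_comp _ _ _ (fun w : (X1 * X2) * (R * R) => (w.1.1, w.2.1))
      (fun p => cone_pt p.1 p.2)); last exact: continuous_cone_pt.
    apply: (@cvg_pair _ _ _ _ (nbhs w.1.1) (nbhs w.2.1)).
      by apply: (@cvg_comp _ _ _ fst fst); [exact: cvg_fst|exact: cvg_fst].
    by apply: (@cvg_comp _ _ _ snd fst); [exact: cvg_snd|exact: cvg_fst].
  apply: (@continuous_comp _ _ _ (fun w : (X1 * X2) * (R * R) => (w.1.2, w.2.2))
    (fun p => cone_pt p.1 p.2)); last exact: continuous_cone_pt.
  apply: (@cvg_pair _ _ _ _ (nbhs w.1.2) (nbhs w.2.2)).
    by apply: (@cvg_comp _ _ _ fst snd); [exact: cvg_fst|exact: cvg_snd].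
  by apply: (@cvg_comp _ _ _ snd snd); [exact: cvg_snd|exact: cvg_snd].
exact: cg _ ((lower_semicontinuousP H).1 H_lsc a).
Qed.

Hypothesis H_proper : proper_cost H.
Hypothesis H_hom : radially_homogeneous H.

Lemma cost_vertex (x1 : X1) (x2 : X2) : H (cone_pt x1 0, cone_pt x2 0) = 0.
Proof.
have H2 : H (cone_pt x1 0, cone_pt x2 0) =
    2%:E * H (cone_pt x1 0, cone_pt x2 0).
  by rewrite -H_hom ?mulr0.
have : H (cone_pt x1 0, cone_pt x2 0) != +oo.
  apply/eqP => Hoo.
  have [[c1 c2]] := H_proper; rewrite -(cone_ptK c1) -(cone_ptK c2).
  set r1 := cone_rad c1; set r2 := cone_rad c2.
  set y1 := cone_base c1; set y2 := cone_base c2 => Hfin.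
  have Hr : H (cone_pt y1 r1, cone_pt y2 r2) \is a fin_num.
    by rewrite ge0_fin_numE// lt_neqAle Hfin leey.
  have r10 : (0 <= r1)%R := cone_rad_ge0 c1.
  have r20 : (0 <= r2)%R := cone_rad_ge0 c2.
  have := H_lsc (x := (cone_pt y1 0%R, cone_pt y2 0%R)) (a := 1%R).
  rewrite (cone_pt_vertex y1 x1 (lexx 0%R) (lexx 0%R)).
  rewrite (cone_pt_vertex y2 x2 (lexx 0%R) (lexx 0%R)) Hoo ltry => /(_ isT)[V].
  move=> [[A B] /= [oA oB] ABV] HV.
  move: oA oB; rewrite /nbhs /= /cone_nbhs !cone_rad_pt maxxx eqxx.
  move=> [e e0 eA] [f f0 fB].
  have [h Hh] : exists h, H (cone_pt y1 r1, cone_pt y2 r2) = h%:E.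
    by exists (fine (H (cone_pt y1 r1, cone_pt y2 r2))); rewrite fineK.
  have h0 : (0 <= h)%R by rewrite -lee_fin -Hh.
  have re0 : (0 <= r1 / e)%R by rewrite divr_ge0// ltW.
  have rf0 : (0 <= r2 / f)%R by rewrite divr_ge0// ltW.
  pose D := (1 + h + r1 / e + r2 / f)%R.
  have D0 : (0 < D)%R by rewrite /D; lra.
  have l0 : (0 < D^-1)%R by rewrite invr_gt0.
  have /HV : V (cone_pt y1 (D^-1 * r1), cone_pt y2 (D^-1 * r2)).
    have small r e' : (0 <= r)%R -> (0 < e')%R -> (r / e' < D)%R ->
        (Num.max 0 (D^-1 * r) < e')%R.
      move=> r0 e'0 rD; rewrite max_r; last by rewrite mulr_ge0// ltW.
      by rewrite mulrC ltr_pdivrMr// mulrC -ltr_pdivrMr.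
    apply: ABV; split => /=; [apply: eA|apply: fB];
      rewrite /= cone_rad_pt; apply: small => //; rewrite /D; lra.
  rewrite H_hom// Hh -EFinM lte_fin ltNge => /negP; apply.
  by rewrite mulrC ler_pdivrMr// mul1r /D; lra.
have := H_ge0 (cone_pt x1 0, cone_pt x2 0).
move: H2; case: (H _) => [h|//|//]; rewrite -EFinM => -[].
by move=> hh _; suff -> : h = 0%R by []; lra.
Qed.

Lemma semi_coupling_cost_wrtE (gamma : fmeasure (X1 * X2))
    (g : fmeasure (X1 * X2) * fmeasure (X1 * X2)) :
  g.1 `<< gamma -> g.2 `<< gamma ->
  semi_coupling_cost_wrt H gamma g.1 g.2 = semi_coupling_cost H g.
Proof.
case: g => g1 g2 /= g1gamma g2gamma; rewrite /semi_coupling_cost /=.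
pose m := [the fmeasure (X1 * X2) of measure_add g1 g2].
have mE A : m A = g1 A + g2 A by exact: measure_addE.
have g1m : g1 `<< m.
  apply/null_content_dominatesP => A mA; rewrite [X in X = _ -> _]mE.
  move=> /eqP; rewrite padde_eq0//.
  by move=> /andP[/eqP].
have g2m : g2 `<< m.
  apply/null_content_dominatesP => A mA; rewrite [X in X = _ -> _]mE.
  move=> /eqP; rewrite padde_eq0//.
  by move=> /andP[_ /eqP].
have mgamma : m `<< gamma.
  apply/null_content_dominatesP => A mA A0; rewrite [LHS]mE.
  have /null_content_dominatesP -> // := g1gamma.
  by have /null_content_dominatesP -> // := g2gamma; rewrite adde0.
have mdens (nu la : fmeasure (X1 * X2)) : nu `<< la ->
    measurable_fun setT (density nu la : borel (X1 * X2)%type -> R).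
  move=> nula; have nulaR := @Radon_Nikodym_integrable _ _ _
    (charge_of_finite_measure nu) la nula.
  apply: (measurableT_comp _ (measurable_int _ nulaR)).
  exact: fine_measurable.
pose F p := H (cone_pt p.1 (density g1 m p), cone_pt p.2 (density g2 m p)).
have mF : measurable_fun setT (F : borel (X1 * X2)%type -> \bar R).
  by apply: measurable_cone_cost; exact: mdens.
rewrite [RHS](_ : _ = \int[m]_p F p)//.
rewrite -(Radon_Nikodym_SigmaFinite.change_of_variables mgamma)//; last first.
  by move=> p; exact: H_ge0.
apply: ge0_ae_eq_integral => //.
- by apply: measurable_cone_cost; exact: mdens.
- apply: emeasurable_funM => //.
  exact: measurable_int (Radon_Nikodym_SigmaFinite.f_integrable mgamma).
- by move=> p _; rewrite mule_ge0 ?H_ge0 ?Radon_Nikodym_SigmaFinite.f_ge0.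
have rhoE := ae_eq_Radon_Nikodym_SigmaFinite mgamma measurableT.
have c1 := Radon_Nikodym_chain_rule (nu := charge_of_finite_measure g1) g1m mgamma.
have c2 := Radon_Nikodym_chain_rule (nu := charge_of_finite_measure g2) g2m mgamma.
apply: filterS3 rhoE c1 c2 => p /(_ I) rhoE /(_ I) /= c1 /(_ I) /= c2 _.
have := Radon_Nikodym_SigmaFinite.f_fin_num mgamma p.
have := Radon_Nikodym_SigmaFinite.f_ge0 mgamma p.
rewrite -rhoE in c1 c2; rewrite /density c1 c2 !fineM//; last 4 first.
- exact: Radon_Nikodym_fin_num.
- exact: Radon_Nikodym_SigmaFinite.f_fin_num.
- exact: Radon_Nikodym_fin_num.
- exact: Radon_Nikodym_SigmaFinite.f_fin_num.
rewrite /F; case: (Radon_Nikodym_SigmaFinite.f _ _ p) => [r|//|//].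
rewrite lee_fin /= => r0 _; rewrite -/(density g1 m p) -/(density g2 m p).
rewrite ![(_ * r)%R]mulrC muleC.
move: r0; rewrite le_eqVlt => /predU1P[<-|r0].
  by rewrite !mul0r mul0e cost_vertex.
rewrite -(cone_pt_max0 _ (density g1 m p)) -(cone_pt_max0 _ (density g2 m p)).
rewrite -H_hom// ?le_max ?lexx//.
by rewrite !maxr_pMr ?ltW// !mulr0 !cone_pt_max0.
Qed.

End reference_measure.

(* Main.v *)
Require Import Defs.
From HB Require Import structures.
From mathcomp Require Import all_boot all_order all_algebra.
From mathcomp Require Import lra ring.
From mathcomp Require Import all_classical all_reals all_analysis.
From mathcomp Require Import measurable_realfun.

(** Both kinds of coupling record how much mass each pair of points receives
    from the two sides: a semi-coupling as a pair of measures on [X1 * X2], a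
    homogeneous coupling as a distribution of radii.

    A semi-coupling [g] lifts to a homogeneous coupling of the same cost: if
    [f1] and [f2] are the densities of [g.1] and [g.2] with respect to
    [g.1 + g.2], push [g.1 + g.2] forward along
    [(x1, x2) |-> ([x1, f1], [x2, f2])] ([lift_semi_coupling]).  This gives the
    first inequality.  The image is a Radon measure because densities are
    continuous up to sets of small measure (Lusin).

    Conversely a homogeneous coupling [al] projects to the semi-coupling whose
    components are the images of [r1 al] and [r2 al] on [X1 * X2].  The
    densities of the projection are conditional means of the radii given the
    base points, so for radially convex [H] the cost cannot increase, by
    Jensen's inequality ([project_coupling]).  Conditional measures are avoided
    as follows.  For fixed base points the cost is a convex function on the
    segment [r1 + r2 = 1], hence a supremum of affine functions with slopes in a
    countable set ([cost_sup_intercepts]); the best intercept for a given slope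
    is a lower semicontinuous function of the base points, since the segment is
    compact ([intercept_lsc]).  An affine minorant is, by homogeneity, linear in
    the radii and so integrates to the same value before and after projection;
    splitting [X1 * X2] according to which of finitely many minorants is the
    largest, and letting their number grow, gives the inequality
    ([integral_sup_le]).

    For the existence of a minimizer, lift a minimizing sequence of
    semi-couplings.  The lifts have the same total mass and are carried by
    [r1 + r2 = 1].  They are uniformly tight although the second marginal of
    [g.1] is not controlled: a base point only matters when its radius is not
    small, and since the neighbourhoods of the vertex are uniform in the base
    point, compact subsets of the cone arise from compact sets of base points
    that are allowed to grow as the radius decreases ([cone_compact]).
    Prokhorov's theorem holds in every Hausdorff space in the form needed here
    ([tight_sequence_compact]): an ultrafilter limit of the values on open sets
    is regularized to a Radon measure, and integrals of nonnegative lower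
    semicontinuous functions do not increase in the limit.  This applies to the
    cost, and to the marginals on open sets; since the total mass is preserved,
    the marginals are preserved too ([marginal_eq]).  The projection of the
    limit is a minimizing semi-coupling. *)

Set Implicit Arguments.
Unset Strict Implicit.
Unset Printing Implicit Defensive.

Import Order.TTheory GRing.Theory Num.Theory.
Import numFieldNormedType.Exports.

Local Open Scope classical_set_scope.
Local Open Scope ring_scope.
Local Open Scope ereal_scope.

(** * Compact sets in Hausdorff spaces *)

Section separation.
Context {T : topologicalType}.

(** The finite subcover argument behind both separation steps below: sets of a
    filter that are locally avoidable can be shrunk, finitely many times, to
    one set that is avoided all along [K]. *)
Lemma compact_avoid (K : set T) (F : set_system T) : Filter F -> compact K ->
  (forall x, K x -> exists2 A, F A & nbhs x (~` A)) ->
  exists2 A, F A & K `<=` (~` A)^°.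
Proof.
move=> FF /compact_near_coveringP cK KF.
have [F0|F0] := pselect (F set0).
  by exists set0 => // x _; rewrite setC0 interiorT.
have PF : ProperFilter F by split.
move: cK => /(_ _ (powerset_filter_from F) (fun W x => nbhs x (~` W)))[].
  move=> x /KF[A FA xA].
  have /= : nbhs x (nbhs^~ (~` A)) by exact: nbhs_interior.
  move=> xA'; exists ((nbhs^~ (~` A)), [set W | F W /\ W `<=` A]) => /=.
    by split => //; exact: powerset_filter_fromP.
  by move=> [y W] /= [yA [_ WA]]; apply: filterS yA; exact: subsetC.
move=> G [GF Gd [W GW]] GK; exists W; first exact: GF.
by move=> x; exact: GK.
Qed.

Lemma compact_separated (A B : set T) : hausdorff_space T -> compact A ->
  compact B -> A `&` B = set0 ->
  exists U V : set T, [/\ open U, open V, A `<=` U, B `<=` V & U `&` V = set0].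
Proof.
move=> hT cA cB AB0.
(* Two rounds of the same argument: first a point of [B] is separated from
   [A], then all of [B] is. *)
have [W /set_nbhsP[C [oC AC CW]] BW] : exists2 W, set_nbhs A W & B `<=` (~` W)^°.
  apply: compact_avoid => // b Bb.
  have [D bD AD] : exists2 D, nbhs b D & A `<=` (~` D)^°.
    apply: compact_avoid => // a Aa.
    have ab : b != a.
      apply/eqP => ab; suff : (A `&` B) b by rewrite AB0.
      by split; rewrite // ab.
    move: hT; rewrite open_hausdorff => /(_ _ _ ab)[[U V] /=].
    rewrite !inE => -[Ub Va] [oU oV /eqP UV].
    exists U; first exact: open_nbhs_nbhs.
    apply: filterS (open_nbhs_nbhs (conj oV Va)).
    by apply/disjoints_subset; rewrite setIC; apply/eqP.
  exists (~` D)^°.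
    by move=> a /AD Da; exact: nbhs_interior.
  by apply: filterS bD => y Dy /interior_subset.
exists C, (~` W)^°; split => //; first exact: open_interior.
by apply/seteqP; split => // x [/CW Wx /interior_subset].
Qed.

(** Remove from [K] two disjoint neighbourhoods of the disjoint compact sets
    [K `\` G] and [K `\` H]. *)
Lemma compact_split (K G H : set T) : hausdorff_space T -> compact K ->
  open G -> open H -> K `<=` G `|` H ->
  exists K1 K2, [/\ compact K1, compact K2, K1 `<=` G, K2 `<=` H &
    K = K1 `|` K2].
Proof.
move=> hT cK oG oH KGH.
have cD (E : set T) : open E -> compact (K `\` E).
  by move=> oE; apply: compact_closedI => //; exact: open_closedC.
have [] := @compact_separated (K `\` G) (K `\` H) hT (cD _ oG) (cD _ oH).
  by apply/seteqP; split => // x [[/KGH[]]] // ? ? [].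
move=> U [V [oU oV GU HV UV0]].
exists (K `\` U), (K `\` V); split; [exact: cD|exact: cD| | |].
- by move=> x [Kx Ux]; apply: contrapT => Gx; apply: Ux; exact: GU.
- by move=> x [Kx Ux]; apply: contrapT => Gx; apply: Ux; exact: HV.
rewrite -setDIr UV0.
by apply/seteqP; split => x; [move=> Kx; split => // -[]|case].
Qed.

Lemma compact_bigcup_nat (K : set T) (G : (set T)^nat) : compact K ->
  (forall n, open (G n)) -> K `<=` \bigcup_n G n ->
  exists n, K `<=` \big[setU/set0]_(i < n) G i.
Proof.
move=> /compact_near_coveringP cK oG KG.
move: cK => /(_ _ \oo (fun n x => (\big[setU/set0]_(i < n) G i) x))[].
  move=> x /KG[n _ Gx]; exists (G n, [set k | (n < k)%N]) => /=.
    by split; [exact: open_nbhs_nbhs|exact: nbhs_infty_gt].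
  move=> [y k] /= [Gy nk]; rewrite -bigcup_mkord.
  by exists n.
by move=> n _ /(_ n (leqnn n)) h; exists n.
Qed.

End separation.

(** * Radon measures from contents on open sets *)

Lemma compact_measurable_borel (T : ptopologicalType) (K : set T) :
  hausdorff_space T -> compact K -> measurable (K : set (borel T)).
Proof.
move=> hT cK; rewrite -(setCK K); apply: measurableC.
by apply: open_measurable_borel; rewrite openC; exact: compact_closed.
Qed.

(** Caratheodory's construction for a set function [la] that is only
    meaningful on open sets, such as a limit of measures: [la] is regularized
    from outside on compact sets, then from inside on open sets, then from
    outside again. *)
Section content_extension.
Variables (R : realType) (T : ptopologicalType).
Hypothesis hT : hausdorff_space T.
Variable la : set T -> \bar R.
Hypothesis la_ge0 : forall G, open G -> 0 <= la G.
Hypothesis la0 : la set0 = 0.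
Hypothesis la_subadd : forall G H, open G -> open H ->
  la (G `|` H) <= la G + la H.
Hypothesis la_superadd : forall G H, open G -> open H -> G `&` H = set0 ->
  la G + la H <= la (G `|` H).
Hypothesis la_le : forall G H, open G -> open H -> G `<=` H -> la G <= la H.
Hypothesis la_fin : la setT < +oo.

Definition compact_content (K : set T) : \bar R :=
  ereal_inf [set la G | G in [set G | open G /\ K `<=` G]].

Definition inner_content (G : set T) : \bar R :=
  ereal_sup [set compact_content K | K in [set K | compact K /\ K `<=` G]].

Definition content_outer (A : set T) : \bar R :=
  ereal_inf [set inner_content G | G in [set G | open G /\ A `<=` G]].

Local Notation ka := compact_content.
Local Notation m := inner_content.
Local Notation mu := content_outer.

Lemma compact_content_ge0 K : 0 <= ka K.
Proof. by apply/ereal_infP => _ [G [oG _] <-]; exact: la_ge0. Qed.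

Lemma compact_content_le_open K G : open G -> K `<=` G -> ka K <= la G.
Proof. by move=> oG KG; apply: ereal_inf_lbound; exists G. Qed.

Lemma inner_content_ge K G : compact K -> K `<=` G -> ka K <= m G.
Proof. by move=> cK KG; apply: ereal_sup_ubound; exists K. Qed.

Lemma inner_content_ge0 G : 0 <= m G.
Proof.
apply: le_trans (compact_content_ge0 set0) _.
by apply: inner_content_ge => //; exact: compact0.
Qed.

Lemma inner_content_le_open G : open G -> m G <= la G.
Proof.
move=> oG; apply: ge_ereal_sup => _ [K [cK KG] <-].
exact: compact_content_le_open.
Qed.

Lemma le_inner_content : {homo m : G H / G `<=` H >-> G <= H}.
Proof.
move=> G H GH; apply: ge_ereal_sup => _ [K [cK KG] <-].
by apply: inner_content_ge => //; exact: subset_trans GH.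
Qed.

Lemma compact_content_subadd K L : ka (K `|` L) <= ka K + ka L.
Proof.
have fin X : ka X \is a fin_num.
  rewrite ge0_fin_numE ?compact_content_ge0//.
  apply: le_lt_trans la_fin.
  by apply: compact_content_le_open => //; exact: openT.
apply/lee_addgt0Pr => e e0.
have e2 : (0 < e / 2)%R by rewrite divr_gt0.
have [_ [G [oG KG] <-] Ge] := lb_ereal_inf_adherent e2 (fin K).
have [_ [H [oH LH] <-] He] := lb_ereal_inf_adherent e2 (fin L).
apply: (@le_trans _ _ (la (G `|` H))).
  by apply: compact_content_le_open; [exact: openU|exact: setUSS].
apply: le_trans (la_subadd oG oH) _.
rewrite [X in _ + _ + X%:E]splitr EFinD addeACA.
by rewrite leeD// ltW.
Qed.

(** The Hausdorff property enters here: disjoint compact sets have disjoint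
    neighbourhoods, on which [la] adds up. *)
Lemma compact_content_superadd K L : compact K -> compact L ->
  K `&` L = set0 -> ka K + ka L <= ka (K `|` L).
Proof.
move=> cK cL KL0; apply/ereal_infP => _ [G [oG KLG] <-].
have [U [V [oU oV KU LV UV0]]] := compact_separated hT cK cL KL0.
have oGU : open (G `&` U) by exact: openI.
have oGV : open (G `&` V) by exact: openI.
apply: (@le_trans _ _ (la (G `&` U) + la (G `&` V))).
  apply: leeD; apply: compact_content_le_open => // x.
    by move=> Kx; split; [apply: KLG; left|exact: KU].
  by move=> Lx; split; [apply: KLG; right|exact: LV].
apply: le_trans (la_superadd oGU oGV _) _.
  by rewrite setIACA UV0 setI0.
by apply: la_le => [| |x [[]|[]]] //; apply: openU.
Qed.

Lemma inner_content_subadd G H : open G -> open H -> m (G `|` H) <= m G + m H.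
Proof.
move=> oG oH; apply: ge_ereal_sup => _ [K [cK KGH] <-].
have [K1 [K2 [cK1 cK2 K1G K2H ->]]] := compact_split hT cK oG oH KGH.
apply: le_trans (compact_content_subadd _ _) _.
by apply: leeD; exact: inner_content_ge.
Qed.

Lemma inner_content0 : m set0 = 0.
Proof.
apply/eqP; rewrite eq_le inner_content_ge0 andbT -la0.
by apply: inner_content_le_open; exact: open0.
Qed.

Lemma inner_content_bigcup (G : (set T)^nat) : (forall n, open (G n)) ->
  m (\bigcup_n G n) <= \sum_(n <oo) m (G n).
Proof.
move=> oG; apply: ge_ereal_sup => _ [K [cK /(compact_bigcup_nat cK oG)[n Kn]] <-].
apply: (@le_trans _ _ (m (\big[setU/set0]_(i < n) G i))).
  exact: inner_content_ge.
apply: (@le_trans _ _ (\sum_(i < n) m (G i))).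
  suff : open (\big[setU/set0]_(i < n) G i) /\
    m (\big[setU/set0]_(i < n) G i) <= \sum_(i < n) m (G i) by case.
  elim: n {Kn} => [|n [on mn]].
    by rewrite !big_ord0 inner_content0; split => //; exact: open0.
  rewrite !big_ord_recr /=; split; first exact: openU.
  by apply: le_trans (inner_content_subadd on (oG n)) _; rewrite leeD2r.
rewrite -(big_mkord xpredT (fun i => m (G i))).
by apply: nneseries_lim_ge => // k _ _; exact: inner_content_ge0.
Qed.

Lemma content_outer_ge0 A : 0 <= mu A.
Proof. by apply/ereal_infP => _ [G _ <-]; exact: inner_content_ge0. Qed.

Lemma content_outer_open G : open G -> mu G = m G.
Proof.
move=> oG; apply/eqP; rewrite eq_le; apply/andP; split.
  by apply: ereal_inf_lbound; exists G => //; split.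
by apply/ereal_infP => _ [H [oH GH] <-]; exact: le_inner_content.
Qed.

Lemma content_outer0 : mu set0 = 0.
Proof. by rewrite content_outer_open ?inner_content0//; exact: open0. Qed.

Lemma le_content_outer : {homo mu : A B / A `<=` B >-> A <= B}.
Proof.
move=> A B AB; apply/ereal_infP => _ [H [oH GH] <-].
by apply: ereal_inf_lbound; exists H => //; split => //; exact: subset_trans GH.
Qed.

Lemma content_outer_fin A : mu A \is a fin_num.
Proof.
rewrite ge0_fin_numE ?content_outer_ge0//.
apply: le_lt_trans la_fin; apply: (@le_trans _ _ (mu setT)).
  exact: le_content_outer.
rewrite content_outer_open; last exact: openT.
by apply: inner_content_le_open; exact: openT.
Qed.

Lemma content_outer_sigma_subadditive : sigma_subadditive mu.
Proof.
move=> A; apply/lee_addgt0Pr => e e0.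
have /choice[G GP] : forall n, exists G, [/\ open G, A n `<=` G &
    m G <= mu (A n) + (e / (2 ^ n.+1)%:R)%:E].
  move=> n; have en : (0 < e / (2 ^ n.+1)%:R)%R by rewrite divr_gt0// ltr0n expn_gt0.
  have [_ [G [oG AG] <-] Ge] := lb_ereal_inf_adherent en (content_outer_fin (A n)).
  by exists G; split => //; exact: ltW.
apply: (@le_trans _ _ (m (\bigcup_n G n))).
  apply: ereal_inf_lbound; exists (\bigcup_n G n) => //; split.
    by apply: bigcup_open => n _; case: (GP n).
  by apply: subset_bigcup => n _; case: (GP n).
apply: le_trans (inner_content_bigcup _) _; first by move=> n; case: (GP n).
apply: le_trans (epsilon_trick _ _ (ltW e0)); last first.
  by move=> n; exact: content_outer_ge0.
apply: lee_nneseries => n; first by move=> *; exact: inner_content_ge0.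
by move=> *; case: (GP n).
Qed.

HB.instance Definition _ := isOuterMeasure.Build R T mu
  content_outer0 content_outer_ge0 le_content_outer content_outer_sigma_subadditive.

(** Inside an open set [U], the trace of [G] and the complement of an almost
    optimal compact subset [K] of it are open, and an almost optimal compact
    subset of the latter is disjoint from [K]. *)
Lemma caratheodory_open G : open G -> mu.-caratheodory G.
Proof.
move=> oG; apply: (@le_caratheodory_measurable R T content_outer) => X.
apply/ereal_infP => _ [U [oU XU] <-].
have fin V : open V -> m V \is a fin_num.
  by move=> oV; rewrite -content_outer_open// content_outer_fin.
have oUG : open (U `&` G) by exact: openI.
apply/lee_addgt0Pr => e e0.
have e2 : (0 < e / 2)%R by rewrite divr_gt0.
have [_ [K [cK KG] <-] Ke] := ub_ereal_sup_adherent e2 (fin _ oUG).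
have oUK : open (U `\` K).
  by apply: openI => //; rewrite openC; exact: compact_closed.
have [_ [L [cL LG] <-] Le] := ub_ereal_sup_adherent e2 (fin _ oUK).
apply: (@le_trans _ _ (m (U `&` G) + m (U `\` K))).
  apply: leeD.
    by apply: ereal_inf_lbound; exists (U `&` G) => //; split => //; exact: setSI.
  apply: ereal_inf_lbound; exists (U `\` K) => //; split => // x [Xx Gx].
  by split; [exact: XU|move=> /KG[]].
rewrite -[ereal_sup _]/(m _) in Ke; rewrite -[ereal_sup _]/(m _) in Le.
apply: (@le_trans _ _ ((ka K + (e / 2)%:E) + (ka L + (e / 2)%:E))).
  by apply: leeD; rewrite -leeBlDr// ltW.
rewrite addeACA -EFinD -splitr leeD2r//.
apply: le_trans (compact_content_superadd cK cL _) _.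
  by apply/seteqP; split => // x [Kx /LG[]].
apply: inner_content_ge; first exact: compactU.
by move=> x [/KG[]|/LG[]].
Qed.

Lemma caratheodory_borel (A : set (borel T)) : measurable A -> mu.-caratheodory A.
Proof.
apply: (@smallest_sub _ (sigma_algebra setT) _ mu.-caratheodory).
  split.
  - exact: caratheodory_measurable_set0.
  - by move=> B; rewrite setTD; exact: caratheodory_measurable_setC.
  - exact: caratheodory_measurable_bigcup.
by move=> G; exact: caratheodory_open.
Qed.

Definition content_measure : set (borel T) -> \bar R := mu.

Let content_measure0 : content_measure set0 = 0.
Proof. exact: content_outer0. Qed.

Let content_measure_ge0 A : 0 <= content_measure A.
Proof. exact: content_outer_ge0. Qed.

Let content_measure_sigma_additive : semi_sigma_additive content_measure.
Proof.
move=> F mF tF mUF.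
apply: (@caratheodory_measure_sigma_additive R T content_outer) => //.
- by move=> n; exact: caratheodory_borel.
- exact: caratheodory_borel.
Qed.

HB.instance Definition _ := isMeasure.Build _ (borel T) R content_measure
  content_measure0 content_measure_ge0 content_measure_sigma_additive.

Let content_measure_fin : fin_num_fun content_measure.
Proof. by move=> A _; exact: content_outer_fin. Qed.

HB.instance Definition _ := Measure_isFinite.Build _ _ _ content_measure
  content_measure_fin.

Hypothesis la_tight : forall e : R, (0 < e)%R ->
  exists2 K, compact K & forall G, open G -> K `<=` G -> la setT <= la G + e%:E.

(** The regularization may lose mass in general; tightness prevents it. *)
Lemma content_outer_setT : mu setT = la setT.
Proof.
rewrite content_outer_open; last exact: openT.
apply/eqP; rewrite eq_le; apply/andP; split.
  by apply: inner_content_le_open; exact: openT.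
apply/lee_addgt0Pr => e /la_tight[K cK KG].
rewrite -leeBlDr//; apply: (@le_trans _ _ (ka K)); last first.
  exact: inner_content_ge.
by apply/ereal_infP => _ [G [oG KsG] <-]; rewrite leeBlDr//; exact: KG.
Qed.

(** The measure obtained is outer regular by construction; with tightness, a
    closed set approximating a Borel set from inside can be cut to a compact
    one. *)
Theorem tight_content_extension : exists al : {finite_measure set (borel T) -> \bar R},
  [/\ radon al, al setT = la setT & forall G, open G -> al G <= la G].
Proof.
exists content_measure; split; [|exact: content_outer_setT|]; last first.
  move=> G oG; rewrite [leLHS](content_outer_open oG).
  exact: inner_content_le_open.
have muK K : compact K -> ka K <= mu K.
  move=> cK; apply/ereal_infP => _ [G [oG KG] <-].
  exact: inner_content_ge.
move=> A mA; apply/eqP; rewrite eq_le; apply/andP; split; last first.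
  by apply: ge_ereal_sup => _ [K [cK KA] <-]; exact: le_content_outer.
apply/lee_addgt0Pr => e e0.
have e2 : (0 < e / 2)%R by rewrite divr_gt0.
have [L cL LG] := la_tight e2.
have Ltight : mu (~` L) <= (e / 2)%:E.
  have LT : mu setT = mu L + mu (~` L).
    by rewrite (caratheodory_borel (compact_measurable_borel hT cL) setT) !setTI.
  have : mu setT <= mu L + (e / 2)%:E.
    rewrite content_outer_setT -leeBlDr//.
    apply: le_trans (muK _ cL).
    by apply/ereal_infP => _ [G [oG KsG] <-]; rewrite leeBlDr//; exact: LG.
  by rewrite LT leeD2lE ?content_outer_fin.
have [_ [G [oG AG] <-] Ge] :=
  lb_ereal_inf_adherent e2 (content_outer_fin (~` A)).
have cK : compact (L `\` G).
  by apply: compact_closedI => //; exact: open_closedC.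
have KA : L `\` G `<=` A.
  by move=> x [_ Gx]; apply: contrapT => Ax; apply: Gx; exact: AG.
apply: (@le_trans _ _ (mu (L `\` G) + e%:E)); last first.
  by rewrite leeD2r//; apply: ereal_sup_ubound; exists (L `\` G).
have GA : mu (G `&` A) <= (e / 2)%:E.
  have /esym := caratheodory_borel mA G.
  rewrite (content_outer_open oG) setIC => GE.
  move: Ge; rewrite -[ereal_inf _]/(mu (~` A)) => /ltW; rewrite -GE addeC.
  rewrite (_ : G `&` ~` A = ~` A); last exact/setIidr.
  by rewrite leeD2lE ?content_outer_fin// setIC.
rewrite [X in _ + X%:E]splitr EFinD addeA.
apply: (@le_trans _ _ (mu ((L `\` G) `|` ((G `&` A) `|` ~` L)))).
  apply: le_content_outer => x Ax; have [Lx|] := pselect (L x); last by right; right.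
  by have [Gx|] := pselect (G x); [right; left|left].
apply: le_trans (outer_measureU2 content_outer _ _) _.
rewrite -addeA leeD2l//; apply: le_trans (outer_measureU2 content_outer _ _) _.
exact: leeD.
Qed.

End content_extension.

(** * Compactness of tight sequences of measures *)

(** Along an ultrafilter a bounded sequence converges; this replaces the
    extraction of a subsequence, which could not serve all open sets at once. *)
Lemma ultra_cvg_bounded (R : realType) (U : set_system nat) (u : nat -> R) a b :
  UltraFilter U -> (forall n, (a <= u n <= b)%R) ->
  cvg (u n @[n --> U]).
Proof.
move=> UU uab.
have Uab : (u n @[n --> U]) [set` `[a, b]].
  by apply: (@filterS _ U _ setT) filterT => n _ /=; rewrite in_itv/= uab.
have [p [_ pc]] := @segment_compact R a b (u n @[n --> U]) _ Uab.
apply/cvg_ex; exists p => A pA.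
have [//|UA] := in_ultra_setVsetC (u @^-1` A) UU.
by have [x [/= ? ?]] := pc (~` A) A UA pA.
Qed.

Lemma lsc_measurable (R : realType) (T : ptopologicalType) (f : T -> \bar R) :
  lower_semicontinuous f -> measurable_fun setT (f : borel T -> \bar R).
Proof.
move=> lf; apply: (measurability _ (ErealGenOInfty.measurableE R)).
move=> _ [_ [a ->] <-]; rewrite setTI preimage_itvoy.
by apply: (@open_measurable_borel T); exact: ((lower_semicontinuousP f).1 lf a).
Qed.

Section lsc_approx.
Variables (R : realType) (T : ptopologicalType) (f : T -> \bar R).
Hypothesis f0 : forall x, 0 <= f x.

(** The lattice of levels has mesh [1 / (k + 1)] and reaches up to [k + 1]. *)
Definition superlevel (k i : nat) : set T :=
  [set x | (k.+1%:R^-1 * i.+1%:R)%:E < f x].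

(** A finite layer-cake sum approximating [f] from below. Only indicator
    functions of superlevel sets occur, and these are open when [f] is lower
    semicontinuous. *)
Definition layer (k : nat) (x : T) : R :=
  (k.+1%:R^-1 * \sum_(i < k.+1 * k.+1) \1_(superlevel k i) x)%R.

Lemma layer_ge0 k x : (0 <= layer k x)%R.
Proof.
rewrite /layer mulr_ge0// ?invr_ge0//.
by apply: sumr_ge0.
Qed.

Lemma count_below (y : R) (N : nat) : (0 <= y)%R ->
  (Num.min N%:R (y - 1) <= \sum_(i < N) ((i.+1%:R < y)%R : nat)%:R <= Num.min N%:R y)%R.
Proof.
move=> y0; elim: N => [|N /andP[]].
  by rewrite big_ord0 le_min lexx y0 ge_min lexx.
rewrite big_ord_recr /= -[N.+1]addn1 natrD.
move: (\sum_(i < N) _)%R => S; rewrite !ge_min !le_min.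
move=> h1 /andP[h2 h3]; case: ltP => h /=; apply/and3P; split; lra.
Qed.

Lemma layer_bounds k x (r : R) : f x = r%:E ->
  (Num.min k.+1%:R (r - k.+1%:R^-1) <= layer k x <= r)%R.
Proof.
move=> fx; have r0 : (0 <= r)%R by rewrite -lee_fin -fx.
pose K : R := k.+1%:R; have K0 : (0 < K)%R by rewrite ltr0n.
have := @count_below (K * r) (k.+1 * k.+1) (mulr_ge0 (ltW K0) r0).
rewrite (eq_bigr (fun i : 'I_(k.+1 * k.+1) => \1_(superlevel k i) x)); last first.
  move=> i _; rewrite indicE; congr (nat_of_bool _)%:R.
  apply/idP/idP; rewrite inE /superlevel /= fx lte_fin.
    by rewrite ltr_pdivrMl.
  by rewrite ltr_pdivrMl.
rewrite /layer natrM -/K ge_min le_min !ler_pdivlMl// ler_pdivrMl// => /andP[h].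
move=> /andP[_ ->]; rewrite andbT.
by rewrite (minr_pMr _ _ (ltW K0)) mulrBr divff ?gt_eqF// ge_min.
Qed.

Lemma layer_le k x : (layer k x)%:E <= f x.
Proof.
have := f0 x; case fx : (f x) => [r| |] // _; last exact: leey.
by have /andP[] := layer_bounds k fx.
Qed.

Lemma layer_cvg x : (layer k x)%:E @[k --> \oo] --> f x.
Proof.
have := f0 x; case fx : (f x) => [r| |] // _.
  apply: cvg_EFin; first by near=> k.
  apply: (@squeeze_cvgr _ _ _ _ (fun k => r - k.+1%:R^-1)%R (cst r)).
  - near=> k; have /andP[+ ->] := layer_bounds k fx; rewrite andbT.
    rewrite ge_min => /orP[|//] h.
    apply: le_trans h; rewrite lerBlDr.
    apply: (@le_trans _ _ k.+1%:R); last by rewrite lerDl.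
    apply: (@le_trans _ _ k%:R); last by rewrite ler_nat.
    by near: k; exact: nbhs_infty_ger.
  - rewrite -[X in _ --> X]subr0; apply: cvgB; first exact: cvg_cst.
    exact: cvg_harmonic.
  - exact: cvg_cst.
have -> : (fun k => (layer k x)%:E) = (fun k => k.+1%:R%:E).
  apply/funext => k; congr EFin; rewrite /layer.
  rewrite (eq_bigr (fun=> 1%R)).
    by rewrite sumr_const card_ord natrM mulrA mulVf ?mul1r// pnatr_eq0.
  by move=> i _; rewrite indicE mem_set// /superlevel /= fx ltry.
apply/cvgeyPge => A; near=> k; rewrite lee_fin.
apply: (@le_trans _ _ k%:R); last by rewrite ler_nat.
by near: k; exact: nbhs_infty_ger.
Unshelve. all: end_near. Qed.

End lsc_approx.

Lemma measurable_layer (R : realType) (T : ptopologicalType) (f : T -> \bar R) k :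
  lower_semicontinuous f ->
  measurable_fun setT ((fun x => (layer f k x)%:E) : borel T -> \bar R).
Proof.
move=> lf; apply/measurable_EFinP; apply: measurable_funM => //.
apply: measurable_sum => i; apply: measurable_indic.
by apply: (@open_measurable_borel T); exact: ((lower_semicontinuousP f).1 lf _).
Qed.

Lemma integral_layer (R : realType) (T : ptopologicalType) (f : T -> \bar R)
    (mu : {measure set (borel T) -> \bar R}) (k : nat) :
  lower_semicontinuous f ->
  \int[mu]_x (layer f k x)%:E =
  k.+1%:R^-1%:E * \sum_(i < k.+1 * k.+1) mu (superlevel f k i).
Proof.
move=> lf.
have mS i : measurable (superlevel f k i : set (borel T)).
  by apply: (@open_measurable_borel T); exact: ((lower_semicontinuousP f).1 lf _).
under eq_integral do rewrite /layer EFinM -sumEFin.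
rewrite ge0_integralZl//; last first.
- by move=> x _; apply: sume_ge0 => i _; rewrite lee_fin.
- by apply: emeasurable_sum => i; exact/measurable_EFinP/measurable_indic.
congr (_ * _); rewrite ge0_integral_sum//.
- by apply: eq_bigr => i _; rewrite integral_indic// setIT.
- by move=> i; exact/measurable_EFinP/measurable_indic.
Qed.

Section prokhorov.
Variables (R : realType) (T : ptopologicalType).
Hypothesis hT : hausdorff_space T.
Variables (al : nat -> {finite_measure set (borel T) -> \bar R}) (M : R).
Hypothesis alT : forall n, al n setT = M%:E.
Hypothesis al_tight : forall e : R, (0 < e)%R ->
  exists2 K : set T, compact K & forall n, al n (~` K) <= e%:E.

(** The limit is a measure with at most the limiting mass on every open set
    and with the same total mass. A lower semicontinuous function is
    approximated by its layer sums, whose integrals only involve the mass of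
    open sets. *)
Theorem tight_sequence_compact :
  exists2 be : {finite_measure set (borel T) -> \bar R},
    radon be /\ be setT = M%:E &
    forall (f : T -> \bar R) (b : \bar R), (forall x, 0 <= f x) ->
      lower_semicontinuous f ->
      (\forall n \near \oo, \int[al n]_x f x <= b) -> \int[be]_x f x <= b.
Proof.
have [U [UU Uoo]] := @ultraFilterLemma nat \oo _.
pose la (A : set T) : \bar R := lim (al n A @[n --> U]).
have mo G : open G -> measurable (G : set (borel T)).
  exact: open_measurable_borel.
have cvgla G : open G -> al n G @[n --> U] --> la G.
  move=> oG; have /cvg_ex[l ul] : cvg ((fun n => fine (al n G)) n @[n --> U]).
    apply: (@ultra_cvg_bounded R U _ 0%R M UU) => n.
    rewrite fine_ge0 ?measure_ge0//= -lee_fin fineK ?fin_num_measure//; last exact: mo.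
    rewrite -(alT n); apply: le_measure => //; rewrite inE//; exact: mo.
  have : al n G @[n --> U] --> l%:E.
    apply/fine_cvgP; split; last exact: ul.
    by near=> n; apply: fin_num_measure; exact: mo.
  by move=> h; rewrite /la (cvg_lim _ h)//; exact: ereal_hausdorff.
have la_ge0 G : open G -> 0 <= la G.
  move=> oG; apply: (cvge_to_ge (cvgla _ oG)).
  by near=> n; exact: measure_ge0.
have laT : la setT = M%:E.
  apply: cvg_lim => //; rewrite (_ : (fun n => _) = cst M%:E); first exact: cvg_cst.
  by apply/funext => n; exact: alT.
have la_le G H : open G -> open H -> G `<=` H -> la G <= la H.
  move=> oG oH GH; apply: (lee_cvg_to (cvgla _ oG) (cvgla _ oH)).
  by near=> n; apply: le_measure => //; rewrite inE; exact: mo.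
have cvglaD G H : open G -> open H -> al n G + al n H @[n --> U] --> la G + la H.
  move=> oG oH; apply: cvgeD; [|exact: cvgla|exact: cvgla].
  by apply: ge0_adde_def; rewrite inE la_ge0.
have [be [rbe beT beG]] : exists al : {finite_measure set (borel T) -> \bar R},
    [/\ radon al, al setT = la setT & forall G, open G -> al G <= la G].
  apply: tight_content_extension => //.
  - apply: cvg_lim => //; rewrite (_ : (fun n => _) = cst 0); first exact: cvg_cst.
    by apply/funext => n; rewrite measure0.
  - move=> G H oG oH; apply: (lee_cvg_to (cvgla _ (openU oG oH)) (cvglaD _ _ oG oH)).
    by near=> n; apply: measureU2; exact: mo.
  - move=> G H oG oH GH; apply: (lee_cvg_to (cvglaD _ _ oG oH) (cvgla _ (openU oG oH))).
    by near=> n; rewrite measureU//; exact: mo.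
  - by rewrite laT ltry.
  - move=> e /al_tight[K cK Ke]; exists K => // G oG KG.
    rewrite laT -leeBlDr//; apply: (cvge_to_ge (cvgla _ oG)); near=> n.
    have mK := compact_measurable_borel hT cK.
    rewrite leeBlDr// -(alT n) -(setUv K) measureU ?setICr//; last exact: measurableC.
    apply: leeD; last exact: Ke.
    by apply: le_measure => //; rewrite inE//; exact: mo.
exists be; first by rewrite beT.
move=> f b f0 lf fb.
have bla k : k.+1%:R^-1%:E * \sum_(i < k.+1 * k.+1) la (superlevel f k i) <= b.
  have oS i : open (superlevel f k i) by exact: ((lower_semicontinuousP f).1 lf _).
  (* The layer sums are finite, so the ultrafilter limit passes through them. *)
  have cS : \sum_(i < k.+1 * k.+1) al n (superlevel f k i) @[n --> U] -->
      \sum_(i < k.+1 * k.+1) la (superlevel f k i).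
    apply: cvg_nnesum => i _; last exact: cvgla.
    by near=> n; exact: measure_ge0.
  apply: (cvge_to_le (cvgeZl _ cS)) => //.
  have {}fb : \forall n \near U, \int[al n]_x f x <= b by exact: Uoo.
  apply: filterS fb => n; apply: le_trans; rewrite -integral_layer//.
  apply: ge0_le_integral => //.
  - by move=> x _; rewrite lee_fin layer_ge0.
  - exact: measurable_layer.
  - exact: lsc_measurable.
  - by move=> x _; exact: layer_le.
rewrite (_ : \int[be]_x f x = \int[be]_x limn_einf (fun k => (layer f k x)%:E)); last first.
  by apply: eq_integral => x _; rewrite (cvg_limn_einf_sup (@layer_cvg _ _ _ f0 x)).1.
apply: le_trans (fatou _ _ _ _) _ => //.
- by move=> k; exact: measurable_layer.
- by move=> k x _; rewrite lee_fin layer_ge0.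
rewrite limn_einf_lim; apply: lime_le; first exact: is_cvg_einfs.
near=> k; apply: (@le_trans _ _ (\int[be]_x (layer f k x)%:E)).
  by apply: ereal_inf_lbound; exists k => /=.
rewrite integral_layer//; apply: le_trans (bla k); rewrite lee_pmul2l//.
by apply: lee_sum => i _; apply: beG; exact: ((lower_semicontinuousP f).1 lf _).
Unshelve. all: end_near. Qed.

End prokhorov.

(** * Radon measures and almost continuous maps *)

Section radon_theory.
Variables (R : realType) (T : ptopologicalType).
Hypothesis hT : hausdorff_space T.
Implicit Types mu nu : {finite_measure set (borel T) -> \bar R}.

Lemma radon_inner mu (A : set (borel T)) (e : R) : radon mu -> measurable A ->
  (0 < e)%R ->
  exists K : set T, [/\ compact K, K `<=` A & mu (A `\` K) <= e%:E].
Proof.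
move=> rmu mA e0; have fA := fin_num_measure mu _ mA.
have := rmu _ mA; move=> muA.
have [|_ [K [cK KA] <-] Ke] := ub_ereal_sup_adherent e0
  (S := [set mu K | K in [set K : set T | compact K /\ K `<=` A]]).
  by rewrite -muA.
exists K; split => //; rewrite -muA in Ke.
have mK := compact_measurable_borel hT cK.
have : mu A = mu K + mu (A `\` K).
  rewrite -measureU//; last 2 first.
  - exact: measurableD.
  - by rewrite setDE setIA (setIC K) -setIA setICr setI0.
  by rewrite setDE setUIr setUv setIT; congr (mu _); exact/esym/setUidr.
move=> AE; rewrite AE in Ke.
have fK := fin_num_measure mu _ mK.
by move: Ke => /ltW; rewrite leeBlDr// leeD2lE.
Qed.

Lemma radonP mu : (forall (A : set (borel T)) (e : R), measurable A -> (0 < e)%R ->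
    exists K : set T, [/\ compact K, K `<=` A & mu A <= mu K + e%:E]) ->
  radon mu.
Proof.
move=> h A mA; apply/eqP; rewrite eq_le; apply/andP; split; last first.
  apply: ge_ereal_sup => _ [K [cK KA] <-].
  by apply: le_measure => //; rewrite inE//; exact: compact_measurable_borel.
apply/lee_addgt0Pr => e e0; have [K [cK KA Ke]] := h A e mA e0.
by apply: le_trans Ke _; rewrite leeD2r//; apply: ereal_sup_ubound; exists K.
Qed.

Lemma radon_outer mu (A : set (borel T)) (e : R) : radon mu -> measurable A ->
  (0 < e)%R -> exists G : set T, [/\ open G, A `<=` G & mu G <= mu A + e%:E].
Proof.
move=> rmu mA e0.
have [K [cK KA Ke]] := radon_inner rmu (measurableC mA) e0.
exists (~` K); split.
- by rewrite openC; exact: compact_closed.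
- by move=> x Ax Kx; exact: (KA _ Kx).
have mK := compact_measurable_borel hT cK.
have -> : ~` K = A `|` (~` A `\` K).
  rewrite setDE setUIr setUv setTI; apply/esym/setUidr.
  by move=> x Ax Kx; exact: (KA _ Kx).
rewrite measureU//.
- by rewrite leeD2l.
- by apply: measurableD => //; exact: measurableC.
- by rewrite setDE setIA setICr set0I.
Qed.

End radon_theory.

(** The conclusion of Lusin's theorem. For maps into spaces without a
    countable base it does not follow from measurability, and it is what makes
    an image of a Radon measure a Radon measure. *)
Definition almost_continuous (R : realType) (T : ptopologicalType)
    (Y : topologicalType) (mu : set (borel T) -> \bar R) (f : T -> Y) :=
  forall e : R, (0 < e)%R -> exists K : set T,
    [/\ compact K, mu (~` K) <= e%:E & {within K, continuous f}].

Section almost_continuous_theory.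
Variables (R : realType) (T : ptopologicalType).
Hypothesis hT : hausdorff_space T.
Variable mu : {finite_measure set (borel T) -> \bar R}.
Hypothesis rmu : radon mu.

Let mK (K : set T) : compact K -> measurable (K : set (borel T)).
Proof. exact: compact_measurable_borel. Qed.

Lemma almost_continuous_continuous (Y : topologicalType) (f : T -> Y) :
  continuous f -> almost_continuous mu f.
Proof.
move=> cf e e0; have [K [cK _ Ke]] := radon_inner hT rmu measurableT e0.
exists K; split => //; first by rewrite -setTD.
exact: continuous_subspaceT.
Qed.

Lemma almost_continuous_comp (Y Z : topologicalType) (f : T -> Y) (g : Y -> Z) :
  almost_continuous mu f -> continuous g -> almost_continuous mu (g \o f).
Proof.
move=> af cg e /af[K [cK Ke Kf]]; exists K; split => // x.
exact: (@continuous_comp (subspace K) Y Z f g x (Kf x) (cg _)).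
Qed.

Lemma almost_continuous_pair (Y Z : topologicalType) (f : T -> Y) (g : T -> Z) :
  almost_continuous mu f -> almost_continuous mu g ->
  almost_continuous mu (fun x => (f x, g x)).
Proof.
move=> af ag e e0; have e2 : (0 < e / 2)%R by rewrite divr_gt0.
have [K [cK Ke Kf]] := af _ e2; have [L [cL Le Lg]] := ag _ e2.
exists (K `&` L); split.
- by apply: compact_closedI => //; exact: compact_closed.
- rewrite setCI [X in X%:E]splitr EFinD.
  by apply: le_trans (measureU2 _ _ _) _; [apply: measurableC; exact: mK..|exact: leeD].
- move=> x; apply: cvg_pair.
    exact: (continuous_subspaceW (@subIsetl _ K L) Kf).
  exact: (continuous_subspaceW (@subIsetr _ K L) Lg).
Qed.

(** Used for the base point of an element of the cone, which is continuous off
    the vertex and is given a constant value there. *)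
Lemma almost_continuous_piecewise (Y : topologicalType) (G : set T) (f : T -> Y)
    (y : Y) :
  open G -> {in G, continuous f} -> (forall x, ~ G x -> f x = y) ->
  almost_continuous mu f.
Proof.
move=> oG cf fy e e0; have e2 : (0 < e / 2)%R by rewrite divr_gt0.
have mG : measurable (G : set (borel T)) by exact: open_measurable_borel.
have [K [cK KG Ke]] := radon_inner hT rmu mG e2.
have [L [cL LG Le]] := radon_inner hT rmu (measurableC mG) e2.
exists (K `|` L); split.
- exact: compactU.
- rewrite [X in X%:E]splitr EFinD.
  apply: le_trans (leeD Ke Le).
  apply: le_trans (measureU2 _ _ _); last 2 first.
  + by apply: measurableD => //; exact: mK.
  + by apply: measurableD; [exact: measurableC|exact: mK].
  apply: le_measure; rewrite ?inE.
  + by apply: measurableC; apply: measurableU; exact: mK.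
  + by apply: measurableU; apply: measurableD => //; try exact: measurableC; exact: mK.
  rewrite setCU => x [Kx Lx].
  by have [Gx|Gx] := pselect (G x); [left|right].
- apply: withinU_continuous; [exact: compact_closed|exact: compact_closed| |].
    apply: continuous_in_subspaceT => x; rewrite inE => /KG Gx.
    by apply: cf; rewrite inE.
  apply: (@subspace_eq_continuous _ _ _ (cst y)); last exact: cst_continuous.
  by move=> x; rewrite inE => /LG /fy fx; exact/esym.
Qed.

(** For each interval of a countable base, exhaust its preimage and the
    complement of the preimage by compact sets up to a summable error. On the
    intersection of the resulting compact sets all these preimages are
    relatively open. *)
Lemma lusin (f : borel T -> R) : measurable_fun setT f ->
  almost_continuous mu (f : T -> R).
Proof.
move=> mf e e0.
pose J (n : nat) : set R :=
  if (unpickle n : option (rat * rat)) is Some q then `]ratr q.1, ratr q.2[%classic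
  else set0.
have mI n : measurable (f @^-1` J n).
  rewrite -[X in measurable X]setTI; apply: mf => //.
  by rewrite /J; case: unpickle => [q|]; [exact: measurable_itv|exact: measurable0].
have e2 n : (0 < e / (2 ^ n.+1)%:R / 2)%R.
  by rewrite !divr_gt0// ltr0n expn_gt0.
have /choice[K KP] n := radon_inner hT rmu (mI n) (e2 n).
have /choice[L LP] n := radon_inner hT rmu (measurableC (mI n)) (e2 n).
have cKL n : compact (K n `|` L n).
  by apply: compactU; [case: (KP n)|case: (LP n)].
have mKL n : measurable (K n `|` L n : set (borel T)) by exact: mK.
exists (\bigcap_n (K n `|` L n)); split.
- apply: (@subclosed_compact _ _ (K 0%N `|` L 0%N)) => //.
    by apply: closed_bigI => n _; exact: compact_closed.
  by move=> x; exact.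
- rewrite setC_bigcap.
  apply: (@le_trans _ _ (\sum_(n <oo) mu (~` (K n `|` L n)))).
    apply: measure_sigma_subadditive => //.
      by move=> n; exact: measurableC.
    by apply: bigcup_measurable => n _; exact: measurableC.
  apply: (@le_trans _ _ (\sum_(n <oo) (0 + (e / (2 ^ n.+1)%:R)%:E))).
    apply: lee_nneseries => [n _ _|n _]; first exact: measure_ge0.
    rewrite add0e [X in _ <= X%:E]splitr EFinD.
    have [_ _ Ke] := KP n; have [_ _ Le] := LP n.
    apply: le_trans (leeD Ke Le).
    have mD1 : measurable (f @^-1` J n `\` K n : set (borel T)).
      by apply: measurableD => //; apply: mK; case: (KP n).
    have mD2 : measurable (~` (f @^-1` J n) `\` L n : set (borel T)).
      by apply: measurableD; [exact: measurableC|apply: mK; case: (LP n)].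
    apply: (@le_trans _ _ (mu ((f @^-1` J n `\` K n) `|` (~` (f @^-1` J n) `\` L n)))); last exact: measureU2.
    apply: le_measure; rewrite ?inE; [exact: measurableC|exact: measurableU|].
    rewrite setCU => x [Kx Lx].
    by have [Ix|Ix] := pselect ((f @^-1` J n) x); [left|right].
  apply: le_trans (@epsilon_trick R (cst 0) e xpredT _ (ltW e0)) _ => //.
  by rewrite eseries0 ?add0e.
- apply/subspace_continuousP => x Kx A /nbhs_ballP[d /= d0 dA].
  have /rat_in_itvoo[q1] : (f x - d < f x)%R by rewrite ltrBlDr ltrDl.
  rewrite in_itv/= => /andP[q11 q12].
  have /rat_in_itvoo[q2] : (f x < f x + d)%R by rewrite ltrDl.
  rewrite in_itv/= => /andP[q21 q22].
  have [n InE] : exists n, J n = `]ratr q1, ratr q2[%classic.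
    by exists (pickle (q1, q2)); rewrite /J pickleK.
  have Inx : J n (f x) by rewrite InE /= in_itv/= q12 q21.
  have InA : J n `<=` A.
    rewrite InE => y /=; rewrite in_itv/= => /andP[y1 y2]; apply: dA.
    rewrite /ball /= ltr_distlC (lt_trans q11)//=.
    by rewrite (lt_trans y2).
  have [cL LI _] := LP n.
  have nL : nbhs x (~` L n).
    apply: open_nbhs_nbhs; split; first by rewrite openC; exact: compact_closed.
    by move=> /LI; exact.
  rewrite /= /within /=; apply: filterS nL => y Ly Ky; apply: InA.
  have [_ KJ _] := KP n.
  by have [/KJ|//] := Ky n I.
Qed.

(** Intersect a compact set of almost full measure in the preimage with one on
    which the map is continuous; the image of the intersection is compact. *)
Lemma radon_pushforward (Y : ptopologicalType) (f : T -> Y)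
    (nu : {finite_measure set (borel Y) -> \bar R}) :
  hausdorff_space Y -> measurable_fun setT (f : borel T -> borel Y) ->
  almost_continuous mu f ->
  (forall A : set (borel Y), measurable A -> nu A = mu (f @^-1` A)) -> radon nu.
Proof.
move=> hY mf af nuE; apply: radonP => // A e mA e0.
have e2 : (0 < e / 2)%R by rewrite divr_gt0.
have mfA (B : set (borel Y)) : measurable B -> measurable (f @^-1` B : set (borel T)).
  by move=> mB; rewrite -[X in measurable X]setTI; exact: mf.
have [K [cK Ke Kf]] := af _ e2.
have [L [cL LA Le]] := radon_inner hT rmu (mfA _ mA) e2.
have cKL : compact (L `&` K) by apply: compact_closedI => //; exact: compact_closed.
have cfKL : compact (f @` (L `&` K)).
  apply: continuous_compact => //.
  exact: (continuous_subspaceW (@subIsetr _ L K) Kf).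
have mfKL := compact_measurable_borel hY cfKL.
exists (f @` (L `&` K)); split => //.
  by move=> _ [x [Lx _] <-]; exact: LA.
rewrite !nuE//; apply: (@le_trans _ _ (mu (L `&` K) + e%:E)); last first.
  rewrite leeD2r//; apply: le_measure; rewrite ?inE//; [exact: mK|exact: mfA|].
  by move=> x LKx; exists x.
rewrite [X in _ + X%:E]splitr EFinD.
apply: le_trans (leeD (lexx _) (leeD Le Ke)).
apply: (@le_trans _ _ (mu ((L `&` K) `|` ((f @^-1` A `\` L) `|` ~` K)))).
  apply: le_measure; rewrite ?inE.
  - exact: mfA.
  - apply: measurableU; first exact: mK.
    by apply: measurableU; [apply: measurableD; [exact: mfA|exact: mK]|apply: measurableC; exact: mK].
  move=> x fAx; have [Kx|] := pselect (K x); last by right; right.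
  by have [Lx|] := pselect (L x); [left|right; left].
have mD : measurable (f @^-1` A `\` L : set (borel T)).
  by apply: measurableD; [exact: mfA|exact: mK].
have mKC : measurable (~` K : set (borel T)) by apply: measurableC; exact: mK.
apply: le_trans (measureU2 _ _ _) _; [exact: mK|exact: measurableU|].
by rewrite leeD2l//; apply: measureU2.
Qed.

End almost_continuous_theory.

(** * Topology of the cone *)

Lemma hausdorff_prod (X Y : topologicalType) :
  hausdorff_space X -> hausdorff_space Y -> hausdorff_space (X * Y)%type.
Proof.
move=> hX hY [x y] [x' y'] h; congr pair.
  apply: hX => A B xA yB.
  have h1 : nbhs (x, y) (fst @^-1` A) by exact: (@cvg_fst _ _ (nbhs x) (nbhs y)).
  have h2 : nbhs (x', y') (fst @^-1` B) by exact: (@cvg_fst _ _ (nbhs x') (nbhs y')).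
  by have [[a b] [/= ? ?]] := h _ _ h1 h2; exists a.
apply: hY => A B xA yB.
have h1 : nbhs (x, y) (snd @^-1` A) by exact: (@cvg_snd _ _ (nbhs x) (nbhs y)).
have h2 : nbhs (x', y') (snd @^-1` B) by exact: (@cvg_snd _ _ (nbhs x') (nbhs y')).
by have [[a b] [/= ? ?]] := h _ _ h1 h2; exists b.
Qed.

Section cone_topology.
Variables (R : realType) (X : ptopologicalType).
Local Notation C := (cone R X).

Lemma cone_nbhsE (c : C) : (0 < cone_rad c)%R ->
  nbhs c = (\pi_C)%qT @ nbhs (repr c).
Proof. by move=> c0; rewrite {1}/nbhs /= /cone_nbhs gt_eqF. Qed.

Lemma continuous_cone_rad : continuous (@cone_rad R X).
Proof.
move=> c; have [c0|c0] := eqVneq (cone_rad c) 0%R.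
  move=> A; rewrite /= c0 => /nbhs_ballP[e /= e0 eA].
  rewrite /nbhs /= /nbhs /= /cone_nbhs c0 eqxx; exists e => // d /= de; apply: eA.
  by rewrite /ball /= sub0r normrN ger0_norm// cone_rad_ge0.
have {}c0 : (0 < cone_rad c)%R by rewrite lt0r c0 cone_rad_ge0.
rewrite /continuous_at cone_nbhsE// => A cA.
have := @continuous_radius R X (repr c) A.
rewrite -[\val (repr c).2]/(cone_rad c) => /(_ cA).
by rewrite /= /nbhs /=; apply: filterS => p /=; rewrite cone_rad_pi.
Qed.

Lemma cvg_cone_base (c : C) : (0 < cone_rad c)%R ->
  @cone_base R X d @[d --> c] --> cone_base c.
Proof.
move=> c0; rewrite cone_nbhsE// => A cA.
have h1 : \forall p \near repr c, (0 < \val p.2)%R.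
  exact: (@continuous_radius R X (repr c) _ (lt_nbhsr c0)).
have h2 : \forall p \near repr c, A p.1.
  rewrite [repr c]surjective_pairing.
  exact: (@cvg_fst _ _ (nbhs (repr c).1) (nbhs (repr c).2) _ A cA).
apply: filterS2 h1 h2 => p p0 Ap.
by rewrite /= cone_base_pi// gt_eqF.
Qed.

Lemma cone_rad_gt_open (r : R) : open [set c : C | (r < cone_rad c)%R].
Proof.
apply: (@open_comp _ _ (@cone_rad R X) [set x | (r < x)%R]) => [c _|].
  exact: continuous_cone_rad.
exact: open_gt.
Qed.

Lemma cone_base_open (r : R) (V : set X) : (0 <= r)%R -> open V ->
  open [set c : C | (r < cone_rad c)%R /\ V (cone_base c)].
Proof.
move=> r0 oV; rewrite openE => c [cr Vc].
have c0 : (0 < cone_rad c)%R by exact: le_lt_trans cr.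
have h1 : \forall d \near c, (r < cone_rad d)%R.
  by apply: open_nbhs_nbhs; split => //; exact: cone_rad_gt_open.
have h2 : \forall d \near c, V (cone_base d).
  by apply: (cvg_cone_base c0); exact: open_nbhs_nbhs.
exact: filterS2 h1 h2.
Qed.

(** Two points that cannot be separated have the same radius by continuity,
    and if it is positive the same base point, because the base point is
    continuous there. *)
Lemma hausdorff_cone : hausdorff_space X -> hausdorff_space C.
Proof.
move=> hX c d cd.
have rcd : cone_rad c = cone_rad d.
  apply: (@norm_hausdorff R R) => A B cA dB.
  have [x [/= ? ?]] := cd _ _ (continuous_cone_rad cA) (continuous_cone_rad dB).
  by exists (cone_rad x).
rewrite -(cone_ptK c) -(cone_ptK d) -rcd.
have [c0|c0] := eqVneq (cone_rad c) 0%R.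
  by apply: cone_pt_vertex; rewrite c0.
have {}c0 : (0 < cone_rad c)%R by rewrite lt0r c0 cone_rad_ge0.
suff -> : cone_base c = cone_base d by [].
apply: hX => A B cA dB.
have d0 : (0 < cone_rad d)%R by rewrite -rcd.
have [x [/= ? ?]] := cd _ _ (cvg_cone_base c0 cA) (cvg_cone_base d0 dB).
by exists (cone_base x).
Qed.

(** Since [cone_base] is arbitrary at the vertex, it is replaced there by a
    fixed point, so as to obtain a Borel map. *)
Definition cone_proj (c : C) : X :=
  if (0 < cone_rad c)%R then cone_base c else point.

Lemma cone_projE (c : C) : (0 < cone_rad c)%R -> cone_proj c = cone_base c.
Proof. by rewrite /cone_proj => ->. Qed.

Lemma cone_pt_proj (c : C) : cone_pt (cone_proj c) (cone_rad c) = c.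
Proof.
rewrite /cone_proj; case: ltP => c0; first exact: cone_ptK.
by rewrite -[RHS]cone_ptK; exact: cone_pt_vertex.
Qed.

Lemma cone_base_pt (x : X) (r : R) : (0 < r)%R -> cone_base (cone_pt x r) = x.
Proof. by move=> r0; rewrite cone_base_pi//= max_r ?ltW// gt_eqF. Qed.

(** A filter that does not cluster at the vertex lives on radii bounded away
    from zero, as the neighbourhoods of the vertex are uniform in the base
    point. There the set lies in the image of a product of some [L k] with a
    segment. *)
Lemma cone_compact (L : nat -> set X) : hausdorff_space X ->
  (forall k, compact (L k)) ->
  compact [set c : C | (cone_rad c <= 1)%R /\
    forall k, (k.+1%:R^-1 < cone_rad c)%R -> L k (cone_base c)].
Proof.
move=> hX cL; set K := [set c | _].
have clK : closed K.
  rewrite -[K]setCK; apply: open_closedC.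
  rewrite (_ : ~` K = [set c | (1 < cone_rad c)%R] `|` \bigcup_k
      [set c | (k.+1%:R^-1 < cone_rad c)%R /\ (~` L k) (cone_base c)]).
    apply: openU; first exact: cone_rad_gt_open.
    apply: bigcup_open => k _; apply: cone_base_open => //.
    by rewrite openC; exact: compact_closed.
  apply/seteqP; split => c.
    move=> /not_andP[/negP|/existsNP[k /not_implyP[kc Lc]]].
      by rewrite -ltNge; left.
    by right; exists k.
  move=> [c1 [cK _]|[k _ [kc Lc]] [_ /(_ k kc)]//].
  by move: c1; rewrite /= ltNge cK.
have Ke (e : R) : (0 < e)%R -> compact (K `&` [set c | (e <= cone_rad c)%R]).
  move=> e0.
  have [k ke] : exists k, (k.+1%:R^-1 < e)%R.
    exists (Num.truncn e^-1); rewrite invf_plt ?posrE//.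
    by apply: truncnS_gt; rewrite num_real.
  pose f (p : X * R) : C := cone_pt p.1 p.2.
  apply: (@subclosed_compact _ _ (f @` (L k `*` [set` `[e, 1%R]]))).
  - apply: closedI => //.
    apply: (@closed_comp _ _ (@cone_rad R X) [set x | (e <= x)%R]) => [c _|].
      exact: continuous_cone_rad.
    exact: closed_ge.
  - apply: continuous_compact.
      by apply: continuous_subspaceT; exact: continuous_cone_pt.
    by apply: compact_setX => //; exact: segment_compact.
  - move=> c [[c1 cL'] /= ec]; exists (cone_base c, cone_rad c).
      split => /=; last by rewrite in_itv/= ec.
      by apply: cL'; exact: lt_le_trans ec.
    exact: cone_ptK.
move=> F FF FK.
have [Fv|] := pselect (cluster F (cone_pt point 0)).
  exists (cone_pt point 0); split => //; split.
    by rewrite cone_rad_pt maxxx.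
  by move=> k; rewrite cone_rad_pt maxxx ltNge invr_ge0 ler0n.
move=> /existsNP[A /existsNP[B /not_implyP[FA /not_implyP[]]]].
rewrite /nbhs /= /cone_nbhs cone_rad_pt maxxx eqxx => -[e e0 eB] AB.
have [|c [[Kc _] cF]] := Ke e e0 F FF; last by exists c.
apply: filterS2 FA FK => c Ac Kc; split => //=.
rewrite leNgt; apply/negP => ce; apply: AB; exists c; split => //.
exact: eB.
Qed.

End cone_topology.

(** * Densities and images of finite measures *)

Section density_measure.
Context d (T : measurableType d) (R : realType).
Variables (mu : {finite_measure set T -> \bar R}) (g : T -> R).
Hypothesis g0 : forall x, (0 <= g x)%R.
Hypothesis mg : measurable_fun setT g.
Hypothesis ig : \int[mu]_x (g x)%:E < +oo.

Let mgE (A : set T) : measurable A -> measurable_fun A (EFin \o g).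
Proof. by move=> mA; apply/measurable_EFinP; exact: measurable_funS mg. Qed.

Let nu (A : set T) : \bar R := \int[mu]_(x in A) (g x)%:E.

Let nu0 : nu set0 = 0.
Proof. exact: integral_set0. Qed.

Let nu_ge0 A : 0 <= nu A.
Proof. by apply: integral_ge0 => x _; rewrite lee_fin. Qed.

Let nu_sigma_additive : semi_sigma_additive nu.
Proof.
move=> F mF tF mUF; rewrite /nu ge0_integral_bigcup//.
- apply: (@is_cvg_nneseries R (fun n => nu (F n)) xpredT 0%N) => n _ _.
  exact: nu_ge0.
- exact: mgE.
- by move=> x _; rewrite lee_fin.
Qed.

HB.instance Definition _ := isMeasure.Build _ _ _ nu nu0 nu_ge0 nu_sigma_additive.

Let nu_fin : fin_num_fun nu.
Proof.
move=> A mA; rewrite ge0_fin_numE//; apply: le_lt_trans ig.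
apply: ge0_subset_integral => //; first exact: (mgE measurableT).
by move=> x _; rewrite lee_fin.
Qed.

HB.instance Definition _ := Measure_isFinite.Build _ _ _ nu nu_fin.

Lemma density_measure_exists : exists la : {finite_measure set T -> \bar R},
  forall A, la A = \int[mu]_(x in A) (g x)%:E.
Proof. by exists nu. Qed.

Variable la : {finite_measure set T -> \bar R}.
Hypothesis laE : forall A, measurable A -> la A = \int[mu]_(x in A) (g x)%:E.

Lemma density_dominates : la `<< mu.
Proof.
apply/null_content_dominatesP => A mA A0; rewrite laE//.
by apply: null_set_integral => //; exact: mgE.
Qed.

(** The Radon-Nikodym derivative of [la] coincides with [g] almost everywhere,
    as both have the same integrals. *)
Lemma integral_density (h : T -> \bar R) (E : set T) : measurable E ->
  measurable_fun setT h -> (forall x, 0 <= h x) ->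
  \int[la]_(x in E) h x = \int[mu]_(x in E) (h x * (g x)%:E).
Proof.
move=> mE mh h0; have lamu := density_dominates.
rewrite -(Radon_Nikodym_SigmaFinite.change_of_variables lamu)//; last first.
  exact: measurable_funS mh.
pose f := Radon_Nikodym_SigmaFinite.f la mu.
have mf : mu.-integrable setT f by exact: Radon_Nikodym_SigmaFinite.f_integrable.
have fg : ae_eq mu setT f (EFin \o g).
  apply: integral_ae_eq => //; first exact: mgE.
  by move=> A _ mA; rewrite -laE// (Radon_Nikodym_SigmaFinite.f_integral lamu).
apply: ge0_ae_eq_integral => //.
- apply: emeasurable_funM; first exact: measurable_funS mh.
  by apply: measurable_funS (measurable_int _ mf).
- by apply: emeasurable_funM; [exact: measurable_funS mh|exact: mgE].
- by move=> x _; rewrite mule_ge0// Radon_Nikodym_SigmaFinite.f_ge0.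
- by move=> x _; rewrite mule_ge0// lee_fin.
by apply: filterS fg => x /(_ Logic.I) fg _; rewrite -/(f x) fg.
Qed.

End density_measure.

Section pushforward_finite.
Context d d' (T : measurableType d) (Y : measurableType d') (R : realType).
Variables (mu : {finite_measure set T -> \bar R}) (f : T -> Y).
Hypothesis mf : measurable_fun setT f.

Let nu : set Y -> \bar R := pushforward mu f.

Let nu0 : nu set0 = 0.
Proof. by rewrite /nu /pushforward preimage_set0 measure0. Qed.

Let nu_ge0 A : 0 <= nu A.
Proof. exact: measure_ge0. Qed.

Let mfA A : measurable A -> measurable (f @^-1` A).
Proof. by move=> mA; rewrite -[X in measurable X]setTI; exact: mf. Qed.

Let nu_sigma_additive : semi_sigma_additive nu.
Proof.
move=> F mF tF mUF; rewrite /nu /pushforward preimage_bigcup.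
apply: measure_semi_sigma_additive.
- by move=> n; exact: mfA.
- apply/trivIsetP => /= i j _ _ ij; rewrite -preimage_setI.
  by move/trivIsetP : tF => /(_ _ _ _ _ ij) ->//; rewrite preimage_set0.
- by rewrite -preimage_bigcup; exact: mfA.
Qed.

HB.instance Definition _ := isMeasure.Build _ _ _ nu nu0 nu_ge0 nu_sigma_additive.

Let nu_fin : fin_num_fun nu.
Proof. by move=> A /mfA; exact: fin_num_measure. Qed.

HB.instance Definition _ := Measure_isFinite.Build _ _ _ nu nu_fin.

Lemma pushforward_exists : exists la : {finite_measure set Y -> \bar R},
  forall A, la A = mu (f @^-1` A).
Proof. by exists nu. Qed.

Lemma integral_image (la : {finite_measure set Y -> \bar R}) (h : Y -> \bar R) E :
  (forall A, measurable A -> la A = mu (f @^-1` A)) ->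
  measurable E -> measurable_fun setT h -> (forall y, 0 <= h y) ->
  \int[la]_(y in E) h y = \int[mu]_(x in f @^-1` E) h (f x).
Proof.
move=> laE mE mh h0.
rewrite (eq_measure_integral nu); last by move=> A mA _; exact: laE.
rewrite [LHS](_ : _ = \int[pushforward mu f]_(y in E) h y)//.
rewrite ge0_integral_pushforward//; first exact: measurable_funS mh.
Qed.

End pushforward_finite.

(** Absolute continuity of the integral turns a small [mu]-error of inner
    approximation into a small [la]-error. *)
Lemma radon_density (R : realType) (T : ptopologicalType)
    (mu la : {finite_measure set (borel T) -> \bar R}) (g : borel T -> R) :
  hausdorff_space T -> radon mu -> (forall x, (0 <= g x)%R) ->
  measurable_fun setT g ->
  (forall A, measurable A -> la A = \int[mu]_(x in A) (g x)%:E) -> radon la.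
Proof.
move=> hT rmu g0 mg laE; apply: radonP => // A e mA e0.
have ig : mu.-integrable setT (EFin \o g).
  apply/integrableP; split; first exact/measurable_EFinP.
  rewrite (eq_integral (EFin \o g)); last first.
    by move=> x _ /=; rewrite ger0_norm.
  by rewrite -laE// ltey_eq fin_num_measure.
have [r [r0 rP]] := integral_normr_continuous ig e0.
have r2 : (0 < r / 2)%R by rewrite divr_gt0.
have [K [cK KA Ke]] := radon_inner hT rmu mA r2.
have mK := compact_measurable_borel hT cK.
have mAK : measurable (A `\` K : set (borel T)) by exact: measurableD.
exists K; split => //.
have -> : la A = la K + la (A `\` K).
  rewrite -measureU//; last first.
    by rewrite setDE setIA (setIC K) -setIA setICr setI0.
  by rewrite setDE setUIr setUv setIT; congr (la _); exact/esym/setUidr.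
rewrite leeD2l//.
have : (\int[mu]_(x in A `\` K) `|g x| < e)%R.
  apply: rP => //; apply: le_lt_trans Ke _.
  by rewrite lte_fin ltr_pdivrMr// mulr_natr mulr2n ltrDl.
rewrite /Rintegral -lte_fin fineK.
  move=> /ltW; apply: le_trans; rewrite laE// le_eqVlt; apply/orP; left; apply/eqP.
  by apply: eq_integral => x _ /=; rewrite ger0_norm.
rewrite (eq_integral (EFin \o g)); last by move=> x _ /=; rewrite ger0_norm.
by rewrite -laE// fin_num_measure.
Qed.

(** * Borel maps between base spaces and cones *)

Lemma borel_measurability d (T : measurableType d) (Y : ptopologicalType)
    (D : set T) (f : T -> borel Y) :
  (forall G : set Y, open G -> measurable (D `&` f @^-1` G)) ->
  measurable_fun D f.
Proof.
move=> h; apply: (measurability _ (erefl : @measurable _ (borel Y) = <<s open >>)).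
by move=> _ [G oG <-]; exact: h.
Qed.

Lemma continuous_borel_measurable (T Y : ptopologicalType) (f : T -> Y) :
  continuous f -> measurable_fun setT (f : borel T -> borel Y).
Proof.
move=> /continuousP cf; apply: borel_measurability => G oG.
by rewrite setTI; apply: open_measurable_borel; exact: cf.
Qed.

Lemma continuous_real_measurable (R : realType) (T : ptopologicalType) (f : T -> R) :
  continuous f -> measurable_fun setT (f : borel T -> R).
Proof.
move=> cf; apply: (measurability _ (RGenOInfty.measurableE R)).
move=> _ [_ [a ->] <-]; rewrite setTI preimage_itvoy.
apply: (@open_measurable_borel T).
by apply: (@open_comp _ _ f [set x | (a < x)%R]) => [x _|]; [exact: cf|exact: open_gt].
Qed.

Lemma cvg_cone_proj (R : realType) (X : ptopologicalType) (c : cone R X) :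
  (0 < cone_rad c)%R -> @cone_proj R X d @[d --> c] --> cone_proj c.
Proof.
move=> c0; rewrite cone_projE// => A cA.
have h1 : \forall d \near c, (0 < cone_rad d)%R.
  by apply: open_nbhs_nbhs; split => //; exact: cone_rad_gt_open.
have h2 : \forall d \near c, A (cone_base d) by exact: cvg_cone_base c0 _ cA.
by apply: filterS2 h1 h2 => d d0 Ad; rewrite /= cone_projE.
Qed.

Section cone_pair.
Variables (R : realType) (X1 X2 : ptopologicalType).
Local Notation C1 := (cone R X1).
Local Notation C2 := (cone R X2).
Local Notation CC := (C1 * C2)%type.
Local Notation XX := (X1 * X2)%type.

Lemma measurable_cone_base (X : ptopologicalType) (A : set (borel X)) :
  measurable A ->
  measurable ([set c : cone R X | (0 < cone_rad c)%R /\ A (cone_base c)]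
    : set (borel (cone R X))).
Proof.
move=> mA.
have mB : measurable_fun ([set c | (0 < cone_rad c)%R] : set (borel (cone R X)))
    (@cone_base R X : borel (cone R X) -> borel X).
  apply: borel_measurability => G oG; apply: open_measurable_borel.
  exact: cone_base_open.
by apply: mB => //; apply: open_measurable_borel; exact: cone_rad_gt_open.
Qed.

Lemma measurable_fst_preimage (Y1 Y2 : ptopologicalType) (A : set (borel Y1)) :
  measurable A -> measurable (fst @^-1` A : set (borel (Y1 * Y2)%type)).
Proof.
move=> mA; rewrite -[X in measurable X]setTI.
have cf : continuous (@fst Y1 Y2) by move=> [x y]; exact: cvg_fst.
exact: (continuous_borel_measurable cf).
Qed.

Lemma measurable_snd_preimage (Y1 Y2 : ptopologicalType) (A : set (borel Y2)) :
  measurable A -> measurable (snd @^-1` A : set (borel (Y1 * Y2)%type)).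
Proof.
move=> mA; rewrite -[X in measurable X]setTI.
have cf : continuous (@snd Y1 Y2) by move=> [x y]; exact: cvg_snd.
exact: (continuous_borel_measurable cf).
Qed.

Lemma continuous_rad1 : continuous (fun p : CC => cone_rad p.1).
Proof.
by move=> p; apply: continuous_comp; [exact: cvg_fst|exact: continuous_cone_rad].
Qed.

Lemma continuous_rad2 : continuous (fun p : CC => cone_rad p.2).
Proof.
by move=> p; apply: continuous_comp; [exact: cvg_snd|exact: continuous_cone_rad].
Qed.

Lemma open_rad1_gt0 : open [set p : CC | (0 < cone_rad p.1)%R].
Proof.
apply: (@open_comp _ _ (fun p : CC => cone_rad p.1) [set x | (0 < x)%R]).
  by move=> p _; exact: continuous_rad1.
exact: open_gt.
Qed.

Lemma open_rad2_gt0 : open [set p : CC | (0 < cone_rad p.2)%R].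
Proof.
apply: (@open_comp _ _ (fun p : CC => cone_rad p.2) [set x | (0 < x)%R]).
  by move=> p _; exact: continuous_rad2.
exact: open_gt.
Qed.

Definition cone_lift (w : XX * (R * R)) : CC :=
  (cone_pt w.1.1 w.2.1, cone_pt w.1.2 w.2.2).

Lemma continuous_cone_lift : continuous cone_lift.
Proof.
have lift_coord (X Y : topologicalType) (pX : XX -> X) (pR : R * R -> R) :
    continuous pX -> continuous pR ->
    continuous (fun w : XX * (R * R) => cone_pt (pX w.1) (pR w.2)).
  move=> cX cR w.
  apply: (@continuous_comp _ _ _ (fun w : XX * (R * R) => (pX w.1, pR w.2))
    (fun p => cone_pt p.1 p.2)); last exact: continuous_cone_pt.
  apply: (@cvg_pair _ _ _ _ (nbhs (pX w.1)) (nbhs (pR w.2))).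
    by apply: (@continuous_comp _ _ _ fst pX); [exact: cvg_fst|exact: cX].
  by apply: (@continuous_comp _ _ _ snd pR); [exact: cvg_snd|exact: cR].
move=> w; apply: (@cvg_pair _ _ _ _ (nbhs (cone_pt w.1.1 w.2.1))
    (nbhs (cone_pt w.1.2 w.2.2))).
  by apply: (lift_coord X1 X1 fst fst) => -[x y]; exact: cvg_fst.
by apply: (lift_coord X2 X2 snd snd) => -[x y]; exact: cvg_snd.
Qed.

Section lift.
Variables f1 f2 : borel XX -> R.
Hypotheses (mf1 : measurable_fun setT f1) (mf2 : measurable_fun setT f2).

Let lift (x : XX) : CC := cone_lift (x, (f1 x, f2 x)).

Lemma measurable_lift : measurable_fun setT (lift : borel XX -> borel CC).
Proof.
apply: borel_measurability => G oG; rewrite setTI.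
apply: (@measurable_graph_open R XX f1 f2 (cone_lift @^-1` G)) => //.
by move/continuousP : continuous_cone_lift; exact.
Qed.

Lemma almost_continuous_lift (mu : {finite_measure set (borel XX) -> \bar R}) :
  hausdorff_space XX -> radon mu -> almost_continuous mu lift.
Proof.
move=> hXX rmu.
apply: (almost_continuous_comp (f := fun x => (x, (f1 x, f2 x))) (g := cone_lift)).
  apply: (almost_continuous_pair hXX (f := id) (g := fun x => (f1 x, f2 x))).
    by apply: (almost_continuous_continuous hXX rmu (f := id)) => x; exact: cvg_id.
  by apply: (almost_continuous_pair hXX (f := f1) (g := f2)); exact: lusin.
exact: continuous_cone_lift.
Qed.

End lift.

Definition cone_pair_proj (p : CC) : XX := (cone_proj p.1, cone_proj p.2).

(** The four strata given by the vanishing or not of each radius are treated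
    separately: on each of them the projection is continuous. The preimage of
    an open set is then explicit, even though the Borel sets of a product may
    not be generated by rectangles. *)
Lemma measurable_cone_pair_proj :
  measurable_fun setT (cone_pair_proj : borel CC -> borel XX).
Proof.
apply: borel_measurability => W oW; rewrite setTI.
pose P1 : set CC := [set p | (0 < cone_rad p.1)%R].
pose P2 : set CC := [set p | (0 < cone_rad p.2)%R].
have oP1 : open P1 := open_rad1_gt0.
have oP2 : open P2 := open_rad2_gt0.
have oV1 : open [set x : X1 | W (x, point)].
  have c1 : continuous (fun x : X1 => (x, point : X2)).
    by move=> x; apply: cvg_pair; [exact: cvg_id|exact: cvg_cst].
  by move/continuousP : c1; exact.
have oV2 : open [set x : X2 | W (point, x)].
  have c2 : continuous (fun x : X2 => (point : X1, x)).
    by move=> x; apply: cvg_pair; [exact: cvg_cst|exact: cvg_id].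
  by move/continuousP : c2; exact.
pose E11 : set CC := [set p | (P1 p /\ P2 p) /\ W (cone_base p.1, cone_base p.2)].
have oE11 : open E11.
  rewrite openE => -[c d] [[c0 d0] Wcd].
  have h1 : \forall p \near (c, d), P1 p /\ P2 p.
    by apply: open_nbhs_nbhs; split => //; exact: openI.
  have h2 : \forall p \near (c, d), W (cone_base p.1, cone_base p.2).
    have : (cone_base p.1, cone_base p.2) @[p --> (c, d)] -->
        (cone_base c, cone_base d).
      apply: (@cvg_pair _ _ _ _ (nbhs (cone_base c)) (nbhs (cone_base d))).
        by apply: cvg_comp (cvg_cone_base c0); exact: cvg_fst.
      by apply: cvg_comp (cvg_cone_base d0); exact: cvg_snd.
    by apply; exact: open_nbhs_nbhs.
  exact: filterS2 h1 h2.
pose E10 : set CC := fst @^-1` [set c | (0 < cone_rad c)%R /\ W (cone_base c, point)].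
pose E01 : set CC := snd @^-1` [set c | (0 < cone_rad c)%R /\ W (point, cone_base c)].
pose E00 : set CC := [set p | W (point, point)].
have mE10 : measurable (E10 : set (borel CC)).
  apply: (@measurable_fst_preimage C1 C2); apply: open_measurable_borel.
  exact: (cone_base_open (lexx 0%R) oV1).
have mE01 : measurable (E01 : set (borel CC)).
  apply: (@measurable_snd_preimage C1 C2); apply: open_measurable_borel.
  exact: (cone_base_open (lexx 0%R) oV2).
have mE00 : measurable (E00 : set (borel CC)).
  have [w|w] := pselect (W (point, point)).
    have -> : E00 = setT :> set CC by apply/seteqP; split.
    exact: measurableT.
  have -> : E00 = set0 :> set CC by apply/seteqP; split.
  exact: measurable0.
have mP1 : measurable (P1 : set (borel CC)) by exact: open_measurable_borel.
have mP2 : measurable (P2 : set (borel CC)) by exact: open_measurable_borel.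
have mE11 : measurable (E11 : set (borel CC)) by exact: open_measurable_borel.
pose U : set CC := E11 `|` (E10 `&` ~` P2) `|` (E01 `&` ~` P1) `|`
    (E00 `&` ~` P1 `&` ~` P2).
have WU : cone_pair_proj @^-1` W = U.
  rewrite /U /E11 /E10 /E01 /E00 /P1 /P2; apply/seteqP; split => p.
    rewrite /cone_pair_proj /cone_proj /=.
    case: ifPn => h1; case: ifPn => h2 h.
    - by do 3 left.
    - by left; left; right; split => //; exact/negP.
    - by left; right; split => //; exact/negP.
    - by right; do ! split => //; exact/negP.
  rewrite /cone_pair_proj /cone_proj /=.
  move=> [[[[[-> ->]]//|[[-> h] /negP/negbTE ->]//]|[[-> h] /negP/negbTE ->]//]|].
  by move=> [[h /negP/negbTE ->] /negP/negbTE ->].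
have : measurable (U : set (borel CC)).
  have mP1' : measurable (~` P1 : set (borel CC)) by exact: measurableC.
  have mP2' : measurable (~` P2 : set (borel CC)) by exact: measurableC.
  apply: measurableU; [apply: measurableU; [apply: measurableU|]|] => //.
  - exact: measurableI.
  - exact: measurableI.
  - by apply: measurableI => //; exact: measurableI.
by rewrite -WU.
Qed.

Lemma almost_continuous_cone_pair_proj (mu : {finite_measure set (borel CC) -> \bar R}) :
  hausdorff_space CC -> radon mu -> almost_continuous mu cone_pair_proj.
Proof.
move=> hCC rmu.
apply: (almost_continuous_pair hCC (f := fun p : CC => cone_proj p.1)
  (g := fun p : CC => cone_proj p.2)).
  apply: (almost_continuous_piecewise hCC rmu (G := [set p | (0 < cone_rad p.1)%R])
    (y := point)).
  - exact: open_rad1_gt0.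
  - move=> p; rewrite inE /= => p0.
    by apply: cvg_comp (cvg_cone_proj p0); exact: cvg_fst.
  - by move=> p /negP/negbTE; rewrite /cone_proj => ->.
apply: (almost_continuous_piecewise hCC rmu (G := [set p | (0 < cone_rad p.2)%R])
  (y := point)).
- exact: open_rad2_gt0.
- move=> p; rewrite inE /= => p0.
  by apply: cvg_comp (cvg_cone_proj p0); exact: cvg_snd.
- by move=> p /negP/negbTE; rewrite /cone_proj => ->.
Qed.

End cone_pair.

(** * Lifting a semi-coupling to the cones *)

Section semi_coupling_density.
Local Open Scope charge_scope.
Variables (R : realType) (X1 X2 : ptopologicalType).
Local Notation fmeasure T := {finite_measure set (borel T%type) -> \bar R}.
Local Notation XX := (X1 * X2)%type.
Variables g1 g2 : fmeasure XX.
Variable m : fmeasure XX.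
Hypothesis mE : forall A, measurable A -> m A = g1 A + g2 A.

Lemma summand_dominates (g : fmeasure XX) : g = g1 \/ g = g2 -> g `<< m.
Proof.
move=> gE; apply/null_content_dominatesP => A mA.
rewrite [X in X = _ -> _](mE mA) => /eqP; rewrite padde_eq0//.
by move=> /andP[/eqP g10 /eqP g20]; case: gE => ->.
Qed.

Section one_density.
Variable g : fmeasure XX.
Hypothesis gm : g `<< m.

Lemma measurable_density : measurable_fun setT (density g m : borel XX -> R).
Proof.
have iR := @Radon_Nikodym_integrable _ _ _ (charge_of_finite_measure g) m gm.
apply: (measurableT_comp _ (measurable_int _ iR)).
exact: fine_measurable.
Qed.

Lemma density_ge0_ae : {ae m, forall x : borel XX, (0 <= density g m x)%R}.
Proof.
have := ae_eq_Radon_Nikodym_SigmaFinite gm measurableT.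
apply: filterS => x /(_ Logic.I) E.
by rewrite /density -E fine_ge0// Radon_Nikodym_SigmaFinite.f_ge0.
Qed.

(** The density, corrected on a null set to be nonnegative everywhere. As
    [cone_pt] truncates negative radii, the correction does not change the
    lifted point. *)
Definition pdensity (x : XX) : R := Num.max 0%R (density g m x).

Lemma pdensity_ge0 x : (0 <= pdensity x)%R.
Proof. by rewrite /pdensity le_max lexx. Qed.

Lemma measurable_pdensity : measurable_fun setT (pdensity : borel XX -> R).
Proof. by apply: measurable_maxr => //; exact: measurable_density. Qed.

Lemma pdensityE_ae : {ae m, forall x : borel XX, pdensity x = density g m x}.
Proof.
have := density_ge0_ae.
by apply: filterS => x x0; rewrite /pdensity max_r.
Qed.

Lemma integral_pdensity (A : set (borel XX)) : measurable A ->
  \int[m]_(x in A) (pdensity x)%:E = g A.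
Proof.
move=> mA; rewrite [RHS](Radon_Nikodym_integral (nu := charge_of_finite_measure g) gm mA).
apply: ae_eq_integral => //.
- by apply/measurable_EFinP; apply: measurable_funS measurable_pdensity.
- apply: measurable_funS (measurable_int _ (@Radon_Nikodym_integrable _ _ _ (charge_of_finite_measure g) m gm)) => //.
have := pdensityE_ae; apply: filterS => x -> _.
by rewrite /density fineK// Radon_Nikodym_fin_num.
Qed.

End one_density.

(** The sum of the two densities with respect to [g1 + g2] is the density of
    [g1 + g2] itself. *)
Lemma pdensity_sum_ae :
  {ae m, forall x : borel XX, (pdensity g1 x + pdensity g2 x = 1)%R}.
Proof.
have gm1 : g1 `<< m by apply: summand_dominates; left.
have gm2 : g2 `<< m by apply: summand_dominates; right.
have mp : measurable_fun setT
    ((fun x => (pdensity g1 x + pdensity g2 x)%:E) : borel XX -> \bar R).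
  by apply/measurable_EFinP; apply: measurable_funD; exact: measurable_pdensity.
have : ae_eq m setT (cst 1) (fun x => (pdensity g1 x + pdensity g2 x)%:E).
  apply: integral_ae_eq => //.
    exact: finite_measure_integrable_cst.
  move=> A _ mA; rewrite integral_cst// mul1e [LHS](mE mA).
  under [RHS]eq_integral do rewrite EFinD.
  rewrite ge0_integralD//.
  - by rewrite !integral_pdensity.
  - by move=> x _; rewrite lee_fin pdensity_ge0.
  - by apply/measurable_EFinP; apply: measurable_funS (measurable_pdensity gm1).
  - by move=> x _; rewrite lee_fin pdensity_ge0.
  - by apply/measurable_EFinP; apply: measurable_funS (measurable_pdensity gm2).
by apply: filterS => x /(_ Logic.I)[].
Qed.

End semi_coupling_density.

Lemma radon_add (R : realType) (T : ptopologicalType)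
    (m1 m2 m : {finite_measure set (borel T) -> \bar R}) :
  hausdorff_space T -> radon m1 -> radon m2 ->
  (forall A, measurable A -> m A = m1 A + m2 A) -> radon m.
Proof.
move=> hT r1 r2 mE; apply: radonP => // A e mA e0.
have e2 : (0 < e / 2)%R by rewrite divr_gt0.
have [K [cK KA Ke]] := radon_inner hT r1 mA e2.
have [L [cL LA Le]] := radon_inner hT r2 mA e2.
have mK := compact_measurable_borel hT cK.
have mL := compact_measurable_borel hT cL.
exists (K `|` L); split; first exact: compactU.
  by move=> x [/KA|/LA].
have key (nu : {finite_measure set (borel T) -> \bar R}) (M : set T) :
    measurable (M : set (borel T)) -> M `<=` K `|` L ->
    nu (A `\` M) <= (e / 2)%:E -> nu A <= nu (K `|` L) + (e / 2)%:E.
  move=> mM MKL Me; apply: (@le_trans _ _ (nu M + nu (A `\` M))).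
    apply: (@le_trans _ _ (nu (M `|` (A `\` M)))).
      apply: le_measure; rewrite ?inE//.
        by apply: measurableU => //; exact: measurableD.
      by move=> x Ax; have [Mx|Mx] := pselect (M x); [left|right].
    by apply: measureU2 => //; exact: measurableD.
  apply: leeD => //; apply: le_measure; rewrite ?inE//; exact: measurableU.
rewrite !mE//; last exact: measurableU.
rewrite [X in _ + X%:E]splitr EFinD addeACA.
by apply: leeD; [apply: key mK _ Ke => x; left|apply: key mL _ Le => x; right].
Qed.

Section lift_semi_coupling.
Local Open Scope charge_scope.
Variables (R : realType) (X1 X2 : ptopologicalType).
Hypotheses (hX1 : hausdorff_space X1) (hX2 : hausdorff_space X2).
Local Notation fmeasure T := {finite_measure set (borel T%type) -> \bar R}.
Local Notation XX := (X1 * X2)%type.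
Local Notation CC := (cone R X1 * cone R X2)%type.
Variables (mu1 : fmeasure X1) (mu2 : fmeasure X2) (g : fmeasure XX * fmeasure XX).
Hypothesis sg : semi_coupling mu1 mu2 g.

Let m : fmeasure XX := measure_add g.1 g.2.

Let mE A : measurable A -> m A = g.1 A + g.2 A.
Proof. by move=> _; exact: measure_addE. Qed.

Let gm1 : g.1 `<< m.
Proof. by apply: (summand_dominates mE); left. Qed.

Let gm2 : g.2 `<< m.
Proof. by apply: (summand_dominates mE); right. Qed.

Let f1 := pdensity m g.1.
Let f2 := pdensity m g.2.

Let mf1 : measurable_fun setT (f1 : borel XX -> R).
Proof. exact: measurable_pdensity. Qed.

Let mf2 : measurable_fun setT (f2 : borel XX -> R).
Proof. exact: measurable_pdensity. Qed.

Let lift (x : XX) : CC := cone_lift (x, (f1 x, f2 x)).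

Let rad_lift1 x : cone_rad (lift x).1 = f1 x.
Proof. by rewrite /lift /= cone_rad_pt max_r// /f1 pdensity_ge0. Qed.

Let rad_lift2 x : cone_rad (lift x).2 = f2 x.
Proof. by rewrite /lift /= cone_rad_pt max_r// /f2 pdensity_ge0. Qed.

Let mlift : measurable_fun setT (lift : borel XX -> borel CC).
Proof. exact: measurable_lift. Qed.

Let rm : radon m.
Proof. by case: sg => r1 r2 _ _; apply: radon_add mE => //; exact: hausdorff_prod. Qed.

Let mrad1 : measurable_fun setT ((fun p => cone_rad p.1) : borel CC -> R).
Proof. by apply: (@continuous_real_measurable R CC); exact: continuous_rad1. Qed.

Let mrad2 : measurable_fun setT ((fun p => cone_rad p.2) : borel CC -> R).
Proof. by apply: (@continuous_real_measurable R CC); exact: continuous_rad2. Qed.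

(** Under [lift] the radii become the densities, so the integral of a radius
    over the points above [A] is the mass that the corresponding component
    gives to [A]. By [pdensity_sum_ae] the image is carried by the set of
    radii with sum one. *)
Theorem lift_semi_coupling : exists al : fmeasure CC,
  [/\ homogeneous_coupling mu1 mu2 al,
      al setT = mu1 setT + mu2 setT,
      al [set p | cone_rad p.1 + cone_rad p.2 != 1]%R = 0 &
      forall H : CC -> \bar R, (forall p, 0 <= H p) -> lower_semicontinuous H ->
        \int[al]_p H p = semi_coupling_cost H g].
Proof.
have [rg1 rg2 marg1 marg2] := sg.
have [al alE] := pushforward_exists m mlift.
have hXX := hausdorff_prod hX1 hX2.
have hCC := hausdorff_prod (hausdorff_cone (R := R) hX1) (hausdorff_cone (R := R) hX2).
have intal (h : borel CC -> \bar R) E : measurable E -> measurable_fun setT h ->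
    (forall p, 0 <= h p) -> \int[al]_(p in E) h p = \int[m]_(x in lift @^-1` E) h (lift x).
  by move=> mE' mh h0; apply: integral_image.
have sum1 := pdensity_sum_ae mE.
have total : \int[m]_x (f1 x + f2 x)%:E = m setT.
  under eq_integral do rewrite EFinD.
  rewrite ge0_integralD//; first by rewrite /f1 /f2 !integral_pdensity// [RHS](mE measurableT).
  - by move=> x _; rewrite lee_fin /f1 pdensity_ge0.
  - exact/measurable_EFinP.
  - by move=> x _; rewrite lee_fin /f2 pdensity_ge0.
  - exact/measurable_EFinP.
have oS : open [set p : CC | cone_rad p.1 + cone_rad p.2 != 1]%R.
  apply: (@open_comp _ _ (fun p : CC => cone_rad p.1 + cone_rad p.2)%R
    [set x | x != 1]%R) => [p _|]; last exact: open_neq.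
  by apply: cvgD; [exact: continuous_rad1|exact: continuous_rad2].
exists al; split.
- split.
  + by apply: (radon_pushforward hXX rm hCC mlift) => //; exact: almost_continuous_lift.
  + rewrite intal//; last 2 first.
    * by apply/measurable_EFinP; exact: measurable_funD.
    * by move=> p; rewrite lee_fin addr_ge0// cone_rad_ge0.
    rewrite preimage_setT; under eq_integral do rewrite rad_lift1 rad_lift2.
    by rewrite total ltey_eq fin_num_measure.
  + move=> A mA; rewrite intal//; last 3 first.
    * exact: (@measurable_fst_preimage _ _ _ (measurable_cone_base mA)).
    * exact/measurable_EFinP.
    * by move=> p; rewrite lee_fin cone_rad_ge0.
    rewrite -marg1// -(integral_pdensity gm1); last exact: measurable_fst_preimage.
    rewrite integral_mkcond [RHS]integral_mkcond; apply: eq_integral => x _.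
    rewrite !patchE rad_lift1.
    (* Where the density vanishes both integrands do, and elsewhere the base
       point of the lift is the original point. *)
    have [f0|f0] := ltP 0%R (f1 x).
      congr (if _ then _ else _); apply/idP/idP; rewrite !inE /= cone_base_pt//.
        by rewrite cone_rad_pt lt_max f0 orbT.
      by case.
    rewrite -[pdensity m g.1 x]/(f1 x).
    have -> : f1 x = 0%R by apply/eqP; rewrite eq_le f0 /f1 pdensity_ge0.
    by do 2 case: ifP.
  + move=> A mA; rewrite intal//; last 3 first.
    * exact: (@measurable_snd_preimage _ _ _ (measurable_cone_base mA)).
    * exact/measurable_EFinP.
    * by move=> p; rewrite lee_fin cone_rad_ge0.
    rewrite -marg2// -(integral_pdensity gm2); last exact: measurable_snd_preimage.
    rewrite integral_mkcond [RHS]integral_mkcond; apply: eq_integral => x _.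
    rewrite !patchE rad_lift2.
    have [f0|f0] := ltP 0%R (f2 x).
      congr (if _ then _ else _); apply/idP/idP; rewrite !inE /= cone_base_pt//.
        by rewrite cone_rad_pt lt_max f0 orbT.
      by case.
    rewrite -[pdensity m g.2 x]/(f2 x).
    have -> : f2 x = 0%R by apply/eqP; rewrite eq_le f0 /f2 pdensity_ge0.
    by do 2 case: ifP.
- rewrite alE preimage_setT [LHS](mE measurableT).
  by rewrite -marg1// -marg2//.
- rewrite alE; apply: measure_negligible.
    rewrite -[X in measurable X]setTI; apply: mlift => //.
    exact: open_measurable_borel.
  move: sum1; apply: negligibleS => x /=; rewrite rad_lift1 rad_lift2.
  by move/eqP.
- move=> H H0 lH; rewrite intal//; last exact: lsc_measurable.
  rewrite preimage_setT; apply: eq_integral => x _.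
  by rewrite /lift /cone_lift /= /f1 /f2 /pdensity !cone_pt_max0.
Qed.

End lift_semi_coupling.

(** * Affine minorants of the cost *)

Lemma lt_ereal_between (R : realType) (a : R) (x : \bar R) : a%:E < x ->
  exists2 b, (a < b)%R & b%:E < x.
Proof.
case: x => [y| |] //.
  by rewrite lte_fin => ay; exists ((a + y) / 2)%R; rewrite ?lte_fin; lra.
by move=> _; exists (a + 1)%R; [lra|exact: ltry].
Qed.

Section affine_minorant.
Variables (R : realType) (h : R -> \bar R).
Local Notation I01 := [set t : R | (0 <= t <= 1)%R].
Hypothesis h0 : forall t, 0 <= h t.
Hypothesis hconv : forall t u l, I01 t -> I01 u -> I01 l ->
  h (l * t + (1 - l) * u)%R <= l%:E * h t + (1 - l)%:E * h u.

(** The slope is the supremum of the slopes of the chords from points on the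
    left of [s], at height [h], to [(s, M)]. Convexity bounds these by the
    slopes of chords to the right, since [h s] exceeds [M]. The hypothesis
    near [s] makes the supremum finite; including [- (M / d)] keeps the set
    nonempty when [s = 0] and does not exceed the slopes on the right. *)
Lemma affine_minorant (s M d : R) : I01 s -> (0 < d)%R ->
  (forall t, I01 t -> (`|t - s| < d)%R -> M%:E < h t) ->
  exists b : R, forall t, I01 t -> (M + b * (t - s))%:E <= h t.
Proof.
move=> s01 d0 hd.
have [M0|M0] := ltP M 0%R.
  exists 0%R => t _; rewrite mul0r addr0; apply: le_trans (h0 t).
  by rewrite lee_fin ltW.
pose L : set R := [set b | b = (- (M / d))%R \/
  exists t y, [/\ I01 t, (t < s)%R, h t = y%:E & b = ((M - y) / (s - t))%R]].
have yM t y : I01 t -> h t = y%:E -> (`|t - s| < d)%R -> (M < y)%R.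
  by move=> t01 ty /(hd _ t01); rewrite ty lte_fin.
have y0 t y : h t = y%:E -> (0 <= y)%R by move=> ty; rewrite -lee_fin -ty.
have Lub : ubound L (M / d)%R.
  move=> _ [->|[t [y [t01 ts ty ->]]]].
    by rewrite ge0_cp// divr_ge0// ltW.
  have st : (0 < s - t)%R by rewrite subr_gt0.
  have [std|std] := ltP (s - t)%R d.
    have : (M < y)%R by apply: (yM _ _ t01 ty); rewrite distrC gtr0_norm.
    move=> My; apply: (@le_trans _ _ 0%R); last by rewrite divr_ge0// ltW.
    by rewrite ler_pdivrMr// mul0r subr_le0 ltW.
  rewrite ler_pdivrMr//; apply: (@le_trans _ _ M).
    by rewrite lerBlDr lerDl; exact: (y0 t).
  by rewrite mulrAC ler_pdivlMr// ler_wpM2l.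
have supL : has_sup L.
  by split; [exists (- (M / d))%R; left|exists (M / d)%R].
exists (sup L) => t t01.
have := h0 t; case hty : (h t) => [y| |] // _; last exact: leey.
rewrite lee_fin; have [ts|st|ts] := ltgtP t s.
- have : ((M - y) / (s - t) <= sup L)%R.
    by apply: sup_upper_bound => //; right; exists t, y.
  by rewrite ler_pdivrMr ?subr_gt0// => ?; lra.
- suff : (sup L <= (y - M) / (t - s))%R.
    by rewrite ler_pdivlMr ?subr_gt0// => ?; lra.
  apply: sup_le_ub; first by case: supL.
  have ts0 : (0 < t - s)%R by rewrite subr_gt0.
  move=> _ [->|[u [z [u01 us uz ->]]]].
    have [tsd|tsd] := ltP (t - s)%R d.
      have : (M < y)%R by apply: (yM _ _ t01 hty); rewrite gtr0_norm.
      move=> My; apply: (@le_trans _ _ 0%R).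
        by rewrite oppr_le0 divr_ge0// ltW.
      by rewrite divr_ge0// ltW// subr_gt0.
    rewrite lerNl -mulNr opprB; apply: (@le_trans _ _ (M / (t - s))%R).
      by rewrite ler_pM2r ?invr_gt0// lerBlDr lerDl; exact: (y0 t).
    by rewrite ler_wpM2l// lef_pV2 ?posrE.
  have su : (0 < s - u)%R by rewrite subr_gt0.
  have tu : (0 < t - u)%R by lra.
  rewrite ler_pdivrMr// mulrAC ler_pdivlMr//.
  (* The convexity inequality at [s], written with the weights that express
     [s] as a barycentre of [u] and [t]. *)
  pose l := ((t - s) / (t - u))%R.
  have lE : (1 - l = (s - u) / (t - u))%R.
    by rewrite /l; field; rewrite gt_eqF.
  have l01 : (0 <= l <= 1)%R.
    rewrite /l divr_ge0/=; [|exact: ltW|exact: ltW].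
    by rewrite ler_pdivrMr// mul1r lerD2l lerN2 ltW.
  have := hconv u01 t01 l01.
  have -> : (l * u + (1 - l) * t = s)%R by rewrite lE /l; field; rewrite gt_eqF.
  rewrite uz hty -!EFinM -EFinD => hs.
  have : M%:E < h s by apply: hd => //; rewrite subrr normr0.
  move=> /lt_le_trans/(_ hs); rewrite lte_fin lE /l.
  rewrite mulrAC -(mulrAC _ y) -mulrDl ltr_pdivlMr// => ?; nra.
- have : M%:E < h t by apply: hd => //; rewrite ts subrr normr0.
  by rewrite hty lte_fin ts subrr mulr0 addr0 => /ltW.
Qed.

End affine_minorant.

(** An enumeration of the rationals: a countable family of slopes is what
    allows the supremum over minorants to be taken under the integral. *)
Definition slope (R : realType) (i : nat) : R :=
  if (unpickle i : option rat) is Some q then ratr q else 0%R.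

(** The slope can be moved slightly at the cost of lowering the height from an
    intermediate value [N] to [M]. *)
Lemma affine_minorant_slope (R : realType) (h : R -> \bar R) (s M : R) :
  (forall t, 0 <= h t) ->
  (forall t u l, (0 <= t <= 1)%R -> (0 <= u <= 1)%R -> (0 <= l <= 1)%R ->
    h (l * t + (1 - l) * u)%R <= l%:E * h t + (1 - l)%:E * h u) ->
  lower_semicontinuous h -> (0 <= s <= 1)%R -> M%:E < h s ->
  exists i, forall t, (0 <= t <= 1)%R ->
    (M + slope R i * (t - s))%:E <= h t.
Proof.
move=> h0 hconv hlsc s01 Ms.
have [N MN Ns] := lt_ereal_between Ms.
have [V /nbhs_ballP[e /= e0 eV] hV] := hlsc s N Ns.
have [|b bP] := @affine_minorant R h h0 hconv s N e s01 e0.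
  by move=> t _ ts; apply: hV; apply: eV; rewrite /ball /= distrC.
have /rat_in_itvoo[q] : (b < b + (N - M))%R by lra.
rewrite in_itv/= => /andP[q1 q2].
exists (pickle q) => t t01; apply: le_trans (bP t t01).
by rewrite lee_fin /slope pickleK; nra.
Qed.

(** * Projecting a homogeneous coupling *)

Lemma lee_of_EFin_lt (R : realType) (x y : \bar R) :
  (forall M : R, M%:E < x -> M%:E <= y) -> x <= y.
Proof.
move=> h; rewrite leNgt; apply/negP => yx.
case: x y yx h => [x| |] [y| |] //.
- rewrite lte_fin => yx /(_ ((x + y) / 2)%R); rewrite lte_fin lee_fin => h.
  suff : ((x + y) / 2 <= y)%R by lra.
  by apply: h; lra.
- by move=> _ /(_ (x - 1)%R); rewrite lte_fin ltrBlDr ltrDl ltr01 leeNy_eq => /(_ isT).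
- move=> _ /(_ (y + 1)%R); rewrite ltry lee_fin => /(_ isT) ?; lra.
- by move=> _ /(_ 0%R); rewrite ltry leeNy_eq => /(_ isT).
Qed.

Section integral_sup.
Context d (T : measurableType d) (R : realType).
Variables (mu : {measure set T -> \bar R}) (nu : set T -> \bar R).
Hypothesis nu_ge0 : forall A, measurable A -> 0 <= nu A.
Hypothesis nu_add : forall A B, measurable A -> measurable B ->
  A `&` B = set0 -> nu A + nu B <= nu (A `|` B).
Variable k : nat -> T -> \bar R.
Hypothesis mk : forall i, measurable_fun setT (k i).
Hypothesis k_le : forall i A, measurable A -> (forall x, A x -> 0 <= k i x) ->
  \int[mu]_(x in A) k i x <= nu A.

Let K := fix K N (x : T) := if N is n.+1 then maxe (K n x) (k n x) else 0.

Let KS N x : K N.+1 x = maxe (K N x) (k N x).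
Proof. by []. Qed.

Let K0 N x : 0 <= K N x.
Proof.
elim: N => [//|N IH].
by rewrite KS le_max IH.
Qed.

Let mK N : measurable_fun setT (K N).
Proof.
elim: N => [|N IH].
  exact: measurable_cst.
rewrite (_ : K N.+1 = (fun x => maxe (K N x) (k N x))); last exact/funext/KS.
exact: measurable_maxe.
Qed.

Let int_max_le N A : measurable A -> \int[mu]_(x in A) K N x <= nu A.
Proof.
elim: N A => [|N IH] A mA.
  by rewrite [leLHS]integral0 nu_ge0.
pose B := A `&` [set x | K N x < k N x].
have mB : measurable B.
  by apply: measurableI => //; rewrite -[X in measurable X]setTI; exact: emeasurable_fun_lt.
pose C := A `\` B.
have mC : measurable C by exact: measurableD.
have AE : A = B `|` C.
  by rewrite /C setDE setUIr setUv setIT; apply/esym/setUidr; exact: subIsetl.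
have BC : B `&` C = set0 by rewrite /C setDE setICA setICr setI0.
rewrite AE ge0_integral_setU//.
- apply: le_trans (nu_add mB mC BC); apply: leeD.
    rewrite (eq_integral (k N)).
      by apply: k_le => // x [_ /ltW]; exact: le_trans.
    by move=> x; rewrite in_setE => -[_ kx]; rewrite KS; apply/max_idPr; exact: ltW.
  rewrite (eq_integral (K N)); first exact: IH.
  move=> x; rewrite in_setE => -[Ax Bx]; rewrite KS; apply/max_idPl.
  by rewrite leNgt; apply/negP => kx; exact: Bx.
- by apply: measurable_funS (mK _).
- by apply/disj_setPS; rewrite BC.
Qed.

(** By induction, the maximum of [0] and finitely many [k i] has integral at
    most [nu A] over every [A]: split [A] according to whether the last one
    exceeds the others. Monotone convergence then handles the supremum. *)
Lemma integral_sup_le (f : T -> \bar R) : measurable_fun setT f ->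
  (forall x, 0 <= f x) ->
  {ae mu, forall x, forall M : R, M%:E < f x -> exists i, M%:E <= k i x} ->
  \int[mu]_x f x <= nu setT.
Proof.
move=> mf f0 fk.
have ndK x : {homo K^~ x : m n / (m <= n)%N >-> m <= n}.
  apply/nondecreasing_seqP => n; rewrite KS le_max lexx.
  by [].
have cK x : cvg (K^~ x @ \oo) by exact: ereal_nondecreasing_is_cvgn.
have mlim : measurable_fun setT (fun x => limn (K^~ x)).
  by apply: emeasurable_fun_cvg mK _ => x _; exact: cK.
apply: (@le_trans _ _ (\int[mu]_x limn (K^~ x))).
  apply: ae_ge0_le_integral => //.
  - by move=> x _; apply: lime_ge => //; near=> n; exact: K0.
  - apply: filterS fk => x fk _.
    apply: lee_of_EFin_lt => M /fk[i Mk]; apply: (le_trans Mk).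
    apply: (@le_trans _ _ (K i.+1 x)); first by rewrite KS le_max lexx orbT.
    rewrite (cvg_lim _ (ereal_nondecreasing_cvgn (ndK x)))//.
    by apply: ereal_sup_ubound; exists i.+1.
have cI : cvgn (fun n => \int[mu]_x K n x).
  apply: ereal_nondecreasing_is_cvgn; apply/nondecreasing_seqP => n.
  by apply: ge0_le_integral => // x _; exact: ndK.
have -> : \int[mu]_x limn (K^~ x) = limn (fun n => \int[mu]_x K n x).
  by apply: monotone_convergence => // x _; exact: ndK.
apply: lime_le => //; near=> n; exact: int_max_le.
Unshelve. all: end_near. Qed.

End integral_sup.

Lemma continuous_pair (X Y Z : topologicalType) (f : X -> Y) (g : X -> Z) :
  continuous f -> continuous g -> continuous (fun x => (f x, g x)).
Proof.
by move=> cf cg x; apply: (@cvg_pair _ _ _ _ (nbhs (f x)) (nbhs (g x)));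
  [exact: cf|exact: cg].
Qed.

Lemma continuous_1B (R : realType) (X : topologicalType) (f : X -> R) :
  continuous f -> continuous (fun x => 1 - f x)%R.
Proof. by move=> cf x; apply: cvgB; [exact: cvg_cst|exact: cf]. Qed.

Section lsc_theory.
Variable R : realType.

Lemma lsc_comp (Y Z : topologicalType) (f : Z -> \bar R) (g : Y -> Z) :
  lower_semicontinuous f -> continuous g -> lower_semicontinuous (f \o g).
Proof.
move=> lf cg x a /lf[V gV Vf]; exists (g @^-1` V); first exact: cg.
by move=> y; exact: Vf.
Qed.

Lemma lsc_addr (Y : topologicalType) (f : Y -> \bar R) (g : Y -> R) :
  lower_semicontinuous f -> continuous g ->
  lower_semicontinuous (fun y => f y + (g y)%:E).
Proof.
move=> lf cg x a; rewrite -lteBlDr// -EFinB => /lt_ereal_between[b ab bf].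
have [V xV Vf] := lf _ _ bf.
have gx : (a - b < g x)%R by lra.
exists (V `&` [set y | (a - b < g y)%R]).
  by apply: filterI => //; exact: (cg x _ (lt_nbhsr gx)).
move=> y [/Vf by_ /= gy]; rewrite -lteBlDr// -EFinB.
by apply: lt_trans by_; rewrite lte_fin; lra.
Qed.

(** A strict lower bound at [y] holds on a neighbourhood of the compact set of
    points [(y, t)], hence on a tube around it. *)
Lemma lsc_inf (Y : topologicalType) (F : Y * R -> \bar R) :
  lower_semicontinuous F ->
  lower_semicontinuous (fun y => ereal_inf [set F (y, t) | t in [set` `[0%R, 1%R]]]).
Proof.
move=> lF x a /lt_ereal_between[b ab bF].
have /compact_near_coveringP cI := @segment_compact R 0%R 1%R.
have xb : \forall y \near x, [set` `[0%R, 1%R]] `<=` (fun t => b%:E < F (y, t)).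
  apply: (cI _ (nbhs x) (fun y t => b%:E < F (y, t))) => t t01.
  have : b%:E < F (x, t).
    by apply: (lt_le_trans bF); apply: ereal_inf_lbound; exists t.
  move=> /lF[V [[A B] /= [xA tB] ABV] VF].
  by exists (B, A) => //= -[s y] [/= Bs Ay]; apply: VF; exact: ABV.
exists (fun y => [set` `[0%R, 1%R]] `<=` (fun t => b%:E < F (y, t))) => // y Vb.
apply: (@lt_le_trans _ _ b%:E); first by rewrite lte_fin.
by apply/ereal_infP => _ [t t01 <-]; apply: ltW; exact: Vb.
Qed.

End lsc_theory.

Section support.
Variables (R : realType) (X1 X2 : ptopologicalType).
Local Notation XX := (X1 * X2)%type.
Local Notation CC := (cone R X1 * cone R X2)%type.
Variable H : CC -> \bar R.
Hypothesis H_ge0 : forall p, 0 <= H p.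
Hypothesis H_lsc : lower_semicontinuous H.
Hypothesis H_hom : radially_homogeneous H.

(** Adding a linear function whose coefficients are nonnegative and differ by
    the opposite of the slope reduces affine minorants of arbitrary slope to
    nonnegative constants; this avoids integrating functions of variable sign. *)
Definition slopeN i : R := Num.max 0%R (- slope R i)%R.
Definition slopeP i : R := Num.max 0%R (slope R i).

Lemma slopeN_ge0 i : (0 <= slopeN i)%R.
Proof. by rewrite le_max lexx. Qed.

Lemma slopeP_ge0 i : (0 <= slopeP i)%R.
Proof. by rewrite le_max lexx. Qed.

Lemma slopeNP i : (slope R i + slopeN i - slopeP i = 0)%R.
Proof. by rewrite /slopeN /slopeP !maxEle; case: leP => ?; case: leP => ?; lra. Qed.

Definition tilt i (r : R * R) : R := (slopeN i * r.1 + slopeP i * r.2)%R.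

Definition tilted_cost i (w : XX * R) : \bar R :=
  H (cone_lift (w.1, (w.2, 1 - w.2)%R)) + (tilt i (w.2, 1 - w.2)%R)%:E.

Definition intercept i (x : XX) : \bar R :=
  ereal_inf [set tilted_cost i (x, t) | t in [set` `[0%R, 1%R]]].

Lemma intercept_lsc i : lower_semicontinuous (intercept i).
Proof.
apply: lsc_inf; apply: lsc_addr.
  have cw : continuous (fun w : XX * R => cone_lift (w.1, (w.2, 1 - w.2)%R)).
    have c1 : continuous (@fst XX R) by move=> [y t]; exact: cvg_fst.
    have c2 : continuous (@snd XX R) by move=> [y t]; exact: cvg_snd.
    have c := continuous_pair c1 (continuous_pair c2 (continuous_1B c2)).
    by move=> w; apply: (continuous_comp (c w)); exact: continuous_cone_lift.
  exact: (lsc_comp H_lsc cw).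
move=> w; apply: cvgD; apply: cvgM; try exact: cvg_cst; first exact: cvg_snd.
by apply: (@continuous_1B _ _ snd) => -[y t]; exact: cvg_snd.
Qed.

Lemma intercept_ge0 i x : 0 <= intercept i x.
Proof.
apply/ereal_infP => _ [t /= /[!in_itv]/= /andP[t0 t1] <-].
rewrite adde_ge0// lee_fin /tilt /= addr_ge0// mulr_ge0 ?slopeN_ge0 ?slopeP_ge0//.
by rewrite subr_ge0.
Qed.

(** By homogeneity the inequality on the segment extends to all radii, the
    constant becoming a multiple of [r1 + r2]. When both radii vanish it says
    that [H] is nonnegative. *)
Lemma intercept_minorant i (p : CC) :
  intercept i (cone_pair_proj p) * (cone_rad p.1 + cone_rad p.2)%:E <=
  H p + (tilt i (cone_rad p.1, cone_rad p.2))%:E.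
Proof.
set r1 := cone_rad p.1; set r2 := cone_rad p.2.
have r10 : (0 <= r1)%R := cone_rad_ge0 p.1.
have r20 : (0 <= r2)%R := cone_rad_ge0 p.2.
have tilt0 : (0 <= tilt i (r1, r2))%R.
  by rewrite addr_ge0// mulr_ge0 ?slopeN_ge0 ?slopeP_ge0.
have [s0|s0] := ltP 0%R (r1 + r2)%R; last first.
  have -> : (r1 + r2 = 0)%R by lra.
  by rewrite mule0 adde_ge0.
pose t := (r1 / (r1 + r2))%R.
have t01 : (t \in `[0, 1])%R.
  by rewrite in_itv/= /t divr_ge0//= ?(ltW s0)// ler_pdivrMr//; lra.
have t1 : (1 - t = r2 / (r1 + r2))%R by rewrite /t; field; rewrite gt_eqF.
apply: (@le_trans _ _ (tilted_cost i (cone_pair_proj p, t) * (r1 + r2)%:E)).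
  rewrite lee_pmul2r//; apply: ereal_inf_lbound; exists t => //.
rewrite /tilted_cost /= muleC ge0_muleDr//; last first.
  by rewrite lee_fin addr_ge0// mulr_ge0 ?slopeN_ge0 ?slopeP_ge0//= ?t1 divr_ge0// ltW.
apply: leeD.
  rewrite /cone_lift /= -H_hom//; last 2 first.
  - by rewrite divr_ge0// ltW.
  - by rewrite t1 divr_ge0// ltW.
  have -> : ((r1 + r2) * t = r1)%R by rewrite /t; field; rewrite gt_eqF.
  have -> : ((r1 + r2) * (1 - t) = r2)%R by rewrite t1; field; rewrite gt_eqF.
  by rewrite !cone_pt_proj -surjective_pairing.
rewrite lee_fin t1 /t /tilt /=.
rewrite le_eqVlt; apply/orP; left; apply/eqP; field; rewrite gt_eqF//.
Qed.

Hypothesis H_convex : radially_convex H.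

(** On the segment the tilt with index [i] is affine with slope [- slope R i],
    so it turns the affine minorant of that slope into a constant. *)
Lemma cost_sup_intercepts (x : XX) (s M : R) : (0 <= s <= 1)%R ->
  M%:E < H (cone_lift (x, (s, 1 - s)%R)) ->
  exists i, M%:E <= intercept i x - (tilt i (s, 1 - s)%R)%:E.
Proof.
move=> s01 Ms; pose h t := H (cone_lift (x, (t, 1 - t)%R)).
have [|||i iP] := @affine_minorant_slope R h s M _ _ _ s01 Ms.
- by move=> t; exact: H_ge0.
- move=> t u l t01 u01 l01; rewrite /h /cone_lift /=.
  have -> : (1 - (l * t + (1 - l) * u) = l * (1 - t) + (1 - l) * (1 - u))%R by ring.
  by apply: H_convex => //; lra.
- have ct : continuous (fun t : R => cone_lift (x, (t, 1 - t)%R)).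
    have c1 : continuous (fun t : R => x) by move=> t; exact: cvg_cst.
    have c2 : continuous (fun t : R => t) by move=> t; exact: cvg_id.
    have c := continuous_pair c1 (continuous_pair c2 (continuous_1B c2)).
    by move=> t; apply: (continuous_comp (c t)); exact: continuous_cone_lift.
  exact: (lsc_comp H_lsc ct).
exists i; rewrite leeBrDr// -EFinD.
apply/ereal_infP => _ [t /= /[!in_itv]/= t01 <-].
apply: le_trans (leeD2r _ (iP t t01)); rewrite -EFinD lee_fin /tilt /=.
by have := slopeNP i; nra.
Qed.

End support.

Lemma integral_tilt d (T : measurableType d) (R : realType)
    (mu : {measure set T -> \bar R}) (A : set T) (u v : T -> R) i :
  measurable A -> measurable_fun setT u -> measurable_fun setT v ->
  (forall x, (0 <= u x)%R) -> (forall x, (0 <= v x)%R) ->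
  \int[mu]_(x in A) (tilt i (u x, v x))%:E =
  (slopeN R i)%:E * \int[mu]_(x in A) (u x)%:E +
  (slopeP R i)%:E * \int[mu]_(x in A) (v x)%:E.
Proof.
move=> mA mu' mv u0 v0.
have mE (w : T -> R) : measurable_fun setT w -> measurable_fun A (EFin \o w).
  by move=> mw; apply/measurable_EFinP; exact: measurable_funS mw.
rewrite /tilt /=; under eq_integral do rewrite EFinD.
rewrite ge0_integralD//.
- under eq_integral do rewrite EFinM.
  under [X in _ + X = _]eq_integral do rewrite EFinM.
  rewrite ge0_integralZl//; [|exact: mE|by move=> x _; rewrite lee_fin|].
    rewrite ge0_integralZl//; [exact: mE|by move=> x _; rewrite lee_fin|].
    by rewrite lee_fin slopeP_ge0.
  by rewrite lee_fin slopeN_ge0.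
- by move=> x _; rewrite lee_fin mulr_ge0 ?slopeN_ge0.
- by apply: mE; apply: measurable_funM.
- by move=> x _; rewrite lee_fin mulr_ge0 ?slopeP_ge0.
- by apply: mE; apply: measurable_funM.
Qed.

Section project_coupling.
Local Open Scope charge_scope.
Variables (R : realType) (X1 X2 : ptopologicalType).
Hypotheses (hX1 : hausdorff_space X1) (hX2 : hausdorff_space X2).
Local Notation fmeasure T := {finite_measure set (borel T%type) -> \bar R}.
Local Notation XX := (X1 * X2)%type.
Local Notation CC := (cone R X1 * cone R X2)%type.
Variable H : CC -> \bar R.
Hypothesis H_ge0 : forall p, 0 <= H p.
Hypothesis H_lsc : lower_semicontinuous H.
Hypothesis H_hom : radially_homogeneous H.
Hypothesis H_convex : radially_convex H.
Variables (mu1 : fmeasure X1) (mu2 : fmeasure X2) (al : fmeasure CC).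
Hypothesis hal : homogeneous_coupling mu1 mu2 al.

Let hXX : hausdorff_space XX := hausdorff_prod hX1 hX2.
Let hCC : hausdorff_space CC :=
  hausdorff_prod (hausdorff_cone (R := R) hX1) (hausdorff_cone (R := R) hX2).

Let r1 (p : CC) : R := cone_rad p.1.
Let r2 (p : CC) : R := cone_rad p.2.

Let r1_ge0 p : (0 <= r1 p)%R. Proof. exact: cone_rad_ge0. Qed.
Let r2_ge0 p : (0 <= r2 p)%R. Proof. exact: cone_rad_ge0. Qed.

Let mr1 : measurable_fun setT (r1 : borel CC -> R).
Proof. by apply: (@continuous_real_measurable R CC); exact: continuous_rad1. Qed.

Let mr2 : measurable_fun setT (r2 : borel CC -> R).
Proof. by apply: (@continuous_real_measurable R CC); exact: continuous_rad2. Qed.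

Let mr : measurable_fun setT ((fun p => r1 p + r2 p)%R : borel CC -> R).
Proof. exact: measurable_funD. Qed.

Let mEr (r : CC -> R) (A : set (borel CC)) : measurable_fun setT (r : borel CC -> R) ->
  measurable A -> measurable_fun A ((fun p => (r p)%:E) : borel CC -> \bar R).
Proof. by move=> mr' mA; apply/measurable_EFinP; exact: measurable_funS mr'. Qed.

Let pi := @cone_pair_proj R X1 X2.

Let mpi : measurable_fun setT (pi : borel CC -> borel XX).
Proof. exact: measurable_cone_pair_proj. Qed.

Let mpiA (A : set (borel XX)) : measurable A -> measurable (pi @^-1` A : set (borel CC)).
Proof. by move=> mA; rewrite -[X in measurable X]setTI; exact: mpi. Qed.

Let ir : \int[al]_p (r1 p + r2 p)%:E < +oo.
Proof. by case: hal. Qed.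

Let ir1 : \int[al]_p (r1 p)%:E < +oo.
Proof.
apply: le_lt_trans ir; apply: ge0_le_integral => //.
- by move=> x _; rewrite lee_fin.
- exact: mEr.
- exact: mEr.
- by move=> x _; rewrite lee_fin lerDl.
Qed.

Let ir2 : \int[al]_p (r2 p)%:E < +oo.
Proof.
apply: le_lt_trans ir; apply: ge0_le_integral => //.
- by move=> x _; rewrite lee_fin.
- exact: mEr.
- exact: mEr.
- by move=> x _; rewrite lee_fin lerDr.
Qed.

Let project (r : CC -> R) : (forall p, (0 <= r p)%R) ->
  measurable_fun setT (r : borel CC -> R) -> \int[al]_p (r p)%:E < +oo ->
  exists g : fmeasure XX, radon g /\
    forall A, measurable A -> g A = \int[al]_(p in pi @^-1` A) (r p)%:E.
Proof.
move=> r0 mr' ir'.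
have [D DE] := @density_measure_exists _ (borel CC) R al r r0 mr' ir'.
have ral : radon al by case: hal.
have rD : radon D by apply: (@radon_density R CC al D r hCC ral r0 mr') => A _; exact: DE.
have [g gE] := pushforward_exists D mpi.
exists g; split; last by move=> A mA; rewrite gE DE.
apply: (radon_pushforward hCC rD hXX mpi); last by move=> A _; exact: gE.
exact: almost_continuous_cone_pair_proj.
Qed.

(** Let [m] be the sum of the two components. Then [m] is the image of the
    measure with density [r1 + r2], so [intercept_minorant] integrates to a
    bound of the integral of an intercept by that of the cost plus a tilt. As
    a tilt has the same integral on both sides, it can be subtracted. *)
Theorem project_coupling : exists2 g, semi_coupling mu1 mu2 g &
  semi_coupling_cost H g <= \int[al]_p H p.
Proof.
have [_ _ marg1 marg2] := hal.
have [g1 [rg1 g1E]] := project r1_ge0 mr1 ir1.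
have [g2 [rg2 g2E]] := project r2_ge0 mr2 ir2.
exists (g1, g2).
  split => // A mA /=.
    rewrite g1E; last exact: measurable_fst_preimage.
    rewrite marg1// integral_mkcond [RHS]integral_mkcond; apply: eq_integral => p _.
    rewrite !patchE; have [p0|p0] := ltP 0%R (r1 p).
      congr (if _ then _ else _); apply/idP/idP; rewrite !inE /= cone_projE//.
      by case.
    rewrite -[cone_rad p.1]/(r1 p).
    have -> : r1 p = 0%R by apply/eqP; rewrite eq_le p0 r1_ge0.
    by do 2 case: ifP.
  rewrite g2E; last exact: measurable_snd_preimage.
  rewrite marg2// integral_mkcond [RHS]integral_mkcond; apply: eq_integral => p _.
  rewrite !patchE; have [p0|p0] := ltP 0%R (r2 p).
    congr (if _ then _ else _); apply/idP/idP; rewrite !inE /= cone_projE//.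
    by case.
  rewrite -[cone_rad p.2]/(r2 p).
  have -> : r2 p = 0%R by apply/eqP; rewrite eq_le p0 r2_ge0.
  by do 2 case: ifP.
pose m : fmeasure XX := measure_add g1 g2.
have mE A : measurable A -> m A = g1 A + g2 A by move=> _; exact: measure_addE.
have gm1 : g1 `<< m by apply: (summand_dominates mE); left.
have gm2 : g2 `<< m by apply: (summand_dominates mE); right.
pose f1 := pdensity m g1; pose f2 := pdensity m g2.
have mf1 : measurable_fun setT (f1 : borel XX -> R) by exact: measurable_pdensity.
have mf2 : measurable_fun setT (f2 : borel XX -> R) by exact: measurable_pdensity.
have f10 x : (0 <= f1 x)%R by rewrite /f1 pdensity_ge0.
have f20 x : (0 <= f2 x)%R by rewrite /f2 pdensity_ge0.
have mH : measurable_fun setT (H : borel CC -> \bar R) by exact: lsc_measurable.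
(* The linear terms are determined by the components alone, and these are
   defined by integrating the radii. *)
have tilt_int i A : measurable A ->
    \int[m]_(x in A) (tilt i (f1 x, f2 x))%:E =
    \int[al]_(p in pi @^-1` A) (tilt i (r1 p, r2 p))%:E.
  move=> mA; have mpA := mpiA mA; rewrite !integral_tilt//.
  by rewrite (integral_pdensity gm1 mA) (integral_pdensity gm2 mA) g1E// g2E.
have [D DE] := @density_measure_exists _ (borel CC) R al
  (fun p => r1 p + r2 p)%R (fun p => addr_ge0 (r1_ge0 p) (r2_ge0 p)) mr ir.
have mD A : measurable A -> m A = D (pi @^-1` A).
  move=> mA; rewrite [LHS](mE _ mA) DE g1E// g2E//.
  under [RHS]eq_integral do rewrite EFinD.
  rewrite ge0_integralD//.
  - exact: mpiA.
  - by move=> p _; rewrite lee_fin.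
  - exact: mEr (mpiA mA).
  - by move=> p _; rewrite lee_fin.
  - exact: mEr (mpiA mA).
have mc i : measurable_fun setT (intercept H i : borel XX -> \bar R).
  by apply: (@lsc_measurable R XX); exact: intercept_lsc.
have mtilt i : measurable_fun setT
    ((fun x => (tilt i (f1 x, f2 x))%:E) : borel XX -> \bar R).
  by apply/measurable_EFinP; apply: measurable_funD; exact: measurable_funM.
have tilt_ge0 i (a b : R) : (0 <= a)%R -> (0 <= b)%R -> (0 <= tilt i (a, b))%R.
  by move=> a0 b0; rewrite addr_ge0// mulr_ge0 ?slopeN_ge0 ?slopeP_ge0.
pose k i (x : borel XX) : \bar R := intercept H i x - (tilt i (f1 x, f2 x))%:E.
pose nu (A : set (borel XX)) := \int[al]_(p in pi @^-1` A) H p.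
have cost_le : \int[m]_x H (cone_lift (x, (f1 x, f2 x))) <= nu setT.
  apply: (@integral_sup_le _ _ _ m nu _ _ k).
  - by move=> A mA; apply: integral_ge0.
  - move=> A B mA mB AB; rewrite /nu preimage_setU ge0_integral_setU//; last 4 first.
    + exact: mpiA.
    + exact: mpiA.
    + exact: measurable_funS mH.
    + by apply/disj_setPS; rewrite -preimage_setI AB preimage_set0.
  - move=> i; apply: emeasurable_funB => //; exact: mtilt.
  - move=> i A mA k0.
    have mpA := mpiA mA.
    have finL : \int[m]_(x in A) (tilt i (f1 x, f2 x))%:E \is a fin_num.
      rewrite integral_tilt// (integral_pdensity gm1 mA) (integral_pdensity gm2 mA).
      by rewrite fin_numD !fin_numM// fin_num_measure.
    rewrite -(leeD2rE _ _ finL).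
    apply: (@le_trans _ _ (\int[m]_(x in A) intercept H i x)).
      rewrite -ge0_integralD//.
      + rewrite le_eqVlt; apply/orP; left; apply/eqP.
        by apply: eq_integral => x _; rewrite /k subeK.
      + apply: measurable_funS (_ : measurable_fun setT (k i)) => //.
        by apply: emeasurable_funB => //; exact: mtilt.
      + by move=> x _; rewrite lee_fin tilt_ge0.
      + by apply: measurable_funS (mtilt i).
    rewrite (integral_image mpi mD mA)//; last exact: intercept_ge0.
    have mcpi : measurable_fun setT ((fun p => intercept H i (pi p)) : borel CC -> \bar R).
      exact: measurableT_comp (mc i) mpi.
    have -> : \int[D]_(p in pi @^-1` A) intercept H i (pi p) =
        \int[al]_(p in pi @^-1` A) (intercept H i (pi p) * (r1 p + r2 p)%:E).
      apply: (@integral_density _ (borel CC) R al (fun p => r1 p + r2 p)%R) => //.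
      - by move=> p; rewrite addr_ge0.
      - by move=> p; exact: intercept_ge0.
    have mtiltr : measurable_fun setT ((fun p => tilt i (r1 p, r2 p)) : borel CC -> R).
      by apply: measurable_funD; exact: measurable_funM.
    rewrite tilt_int// -ge0_integralD//; last 3 first.
    + exact: measurable_funS mH.
    + by move=> p _; rewrite lee_fin tilt_ge0.
    + exact: (mEr mtiltr mpA).
    apply: ge0_le_integral => //.
    + by move=> p _; rewrite mule_ge0 ?intercept_ge0// lee_fin addr_ge0.
    + by apply: emeasurable_funM; [exact: measurable_funS mcpi|exact: mEr].
    + apply: emeasurable_funD; first exact: measurable_funS mH.
      exact: (mEr mtiltr mpA).
    + by move=> p _; exact: intercept_minorant.
  - exact: (measurableT_comp mH (measurable_lift mf1 mf2)).
  - by [].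
  - have := pdensity_sum_ae mE; apply: filterS => x f12 M.
    have {}f12 : (f1 x + f2 x = 1)%R by [].
    have f2E : f2 x = (1 - f1 x)%R by lra.
    rewrite f2E.
    move=> Mx; have f101 : (0 <= f1 x <= 1)%R by rewrite f10/=; have := f20 x; lra.
    have [i iM] := cost_sup_intercepts H_ge0 H_lsc H_convex f101 Mx.
    by exists i; rewrite /k f2E.
apply: le_trans cost_le; rewrite le_eqVlt; apply/orP; left; apply/eqP.
apply: eq_integral => x _.
by rewrite /cone_lift /= /f1 /f2 /pdensity !cone_pt_max0.
Qed.

End project_coupling.

(** * Homogeneous marginals in the limit *)

(** The map [rho] stands for either of the two projections onto a cone. *)
Section homogeneous_marginal.
Variables (R : realType) (X Z : ptopologicalType) (rho : Z -> cone R X).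
Hypothesis crho : continuous rho.
Variable al : {finite_measure set (borel Z) -> \bar R}.

Definition cone_over (r : R) (A : set X) : set Z :=
  [set z | (r < cone_rad (rho z))%R /\ A (cone_base (rho z))].

Definition homogeneous_marginal (A : set X) : \bar R :=
  \int[al]_(z in cone_over 0 A) (cone_rad (rho z))%:E.

Local Notation marg := homogeneous_marginal.

Lemma continuous_rad_comp : continuous (fun z => cone_rad (rho z)).
Proof.
move=> z; apply: (@continuous_comp _ _ _ rho (@cone_rad R X)); first exact: crho.
exact: continuous_cone_rad.
Qed.

Lemma measurable_rad_comp :
  measurable_fun setT ((fun z => cone_rad (rho z)) : borel Z -> R).
Proof. exact: (continuous_real_measurable continuous_rad_comp). Qed.

Let mrad (D : set (borel Z)) : measurable D ->
  measurable_fun D ((fun z => (cone_rad (rho z))%:E) : borel Z -> \bar R).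
Proof.
by move=> mD; apply/measurable_EFinP; exact: measurable_funS measurable_rad_comp.
Qed.

Lemma open_cone_over r A : (0 <= r)%R -> open A -> open (cone_over r A).
Proof.
move=> r0 oA; apply: (@open_comp _ _ rho
  [set c | (r < cone_rad c)%R /\ A (cone_base c)]) => [z _|]; first exact: crho.
exact: cone_base_open.
Qed.

Lemma measurable_cone_over r (A : set (borel X)) : (0 <= r)%R -> measurable A ->
  measurable (cone_over r A : set (borel Z)).
Proof.
move=> r0 mA.
have mrho : measurable_fun setT (rho : borel Z -> borel (cone R X)).
  exact: continuous_borel_measurable.
have -> : cone_over r A = rho @^-1` [set c | (0 < cone_rad c)%R /\ A (cone_base c)] `&`
    rho @^-1` [set c | (r < cone_rad c)%R].
  apply/seteqP; split => z; last by move=> [[_ ?] ?].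
  by move=> [rz Az]; split => //; split => //; exact: le_lt_trans rz.
apply: measurableI; rewrite -[X in measurable X]setTI; apply: mrho => //.
  exact: measurable_cone_base.
by apply: open_measurable_borel; exact: cone_rad_gt_open.
Qed.

Lemma marginal_setT : marg setT = \int[al]_z (cone_rad (rho z))%:E.
Proof.
rewrite /marg integral_mkcond; apply: eq_integral => z _; rewrite patchE.
have [z0|z0] := ltP 0%R (cone_rad (rho z)); first by rewrite mem_set.
have -> : cone_rad (rho z) = 0%R by apply/eqP; rewrite eq_le z0 cone_rad_ge0.
by case: ifP.
Qed.

Lemma le_marginal (A B : set (borel X)) : measurable A -> measurable B ->
  A `<=` B -> marg A <= marg B.
Proof.
move=> mA mB AB; apply: ge0_subset_integral; try exact: measurable_cone_over.
- by apply: mrad; exact: measurable_cone_over.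
- by move=> z _; rewrite lee_fin cone_rad_ge0.
- by move=> z [z0 /AB].
Qed.

Lemma marginal_setC (A : set (borel X)) : measurable A ->
  marg A + marg (~` A) = marg setT.
Proof.
move=> mA; rewrite /marg -ge0_integral_setU//.
- congr (integral _ _ _); apply/seteqP; split => z; first by move=> [[]|[]].
  by move=> [z0 _]; have [Az|Az] := pselect (A (cone_base (rho z))); [left|right].
- exact: measurable_cone_over.
- by apply: measurable_cone_over => //; exact: measurableC.
- apply: mrad; apply: measurableU; apply: measurable_cone_over => //.
  exact: measurableC.
- by move=> z _; rewrite lee_fin cone_rad_ge0.
- by apply/disj_setPS => z [[_ ?] [_ ?]].
Qed.

Lemma marginal_ge (r : R) (A : set (borel X)) : (0 <= r)%R -> measurable A ->
  r%:E * al (cone_over r A) <= marg A.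
Proof.
move=> r0 mA; have mo := measurable_cone_over r0 mA.
apply: (@le_trans _ _ (\int[al]_(z in cone_over r A) (cone_rad (rho z))%:E)).
  rewrite -integral_cst//; apply: ge0_le_integral => //.
  - exact: mrad.
  - by move=> z [/ltW rz _]; rewrite lee_fin.
apply: ge0_subset_integral => //; first exact: measurable_cone_over.
- by apply: mrad; exact: measurable_cone_over.
- by move=> z _; rewrite lee_fin cone_rad_ge0.
- by move=> z [rz Az]; split => //; exact: le_lt_trans rz.
Qed.

Definition marginal_integrand (A : set X) (z : Z) : \bar R :=
  ((cone_rad (rho z))%:E * (\1_(cone_over 0 A) z)%:E).

Lemma integral_marginal_integrand (A : set (borel X)) : measurable A ->
  \int[al]_z marginal_integrand A z = marg A.
Proof.
move=> mA; rewrite [RHS]integral_mkcond; apply: eq_integral => z _.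
by rewrite epatch_indic.
Qed.

Lemma marginal_integrand_ge0 A z : 0 <= marginal_integrand A z.
Proof. by rewrite mule_ge0// lee_fin cone_rad_ge0. Qed.

(** It vanishes off an open set on which it is the continuous radius, and it
    is nonnegative. *)
Lemma lsc_marginal_integrand (A : set X) : open A ->
  lower_semicontinuous (marginal_integrand A).
Proof.
move=> oA z a az; have [a0|a0] := ltP a 0%R.
  exists setT; first exact: filterT.
  by move=> y _; apply: lt_le_trans (marginal_integrand_ge0 A y); rewrite lte_fin.
have Az : cone_over 0 A z.
  apply: contrapT => Az; move: az; rewrite /marginal_integrand indicE memNset//.
  by rewrite mule0 lte_fin ltNge a0.
exists (cone_over 0 A `&` [set y | (a < cone_rad (rho y))%R]).
  apply: filterI.
    by apply: open_nbhs_nbhs; split => //; exact: open_cone_over.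
  apply: (continuous_rad_comp (lt_nbhsr _)).
  by move: az; rewrite /marginal_integrand indicE mem_set// mule1 lte_fin.
by move=> y [Ay ay]; rewrite /marginal_integrand indicE mem_set// mule1 lte_fin.
Qed.

(** Mass at radius above [1 / (k + 1)] and base point outside [L k]
    contributes at least that radius times itself to the marginal of the
    complement of [L k], whence the factor [k + 1] in the hypothesis. *)
Lemma marginal_tight (mu : {finite_measure set (borel X) -> \bar R})
    (L : nat -> set X) (e : R) :
  hausdorff_space X -> (forall k, compact (L k)) ->
  (forall A : set (borel X), measurable A -> mu A = marg A) ->
  al [set z | (1 < cone_rad (rho z))%R] = 0 ->
  (forall k, k.+1%:R%:E * mu (~` L k) <= (e / (2 ^ k.+1)%:R)%:E) ->
  (0 <= e)%R ->
  al (rho @^-1` (~` [set c | (cone_rad c <= 1)%R /\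
    forall k, (k.+1%:R^-1 < cone_rad c)%R -> L k (cone_base c)])) <= e%:E.
Proof.
move=> hX cL muE al1 Le e0.
have mL k : measurable (~` L k : set (borel X)).
  by apply: measurableC; exact: compact_measurable_borel.
set B := [set z | (1 < cone_rad (rho z))%R] in al1.
have mB : measurable (B : set (borel Z)).
  apply: open_measurable_borel.
  apply: (@open_comp _ _ rho [set c | (1 < cone_rad c)%R]) => [z _|].
    exact: crho.
  exact: cone_rad_gt_open.
pose E k := cone_over k.+1%:R^-1 (~` L k).
have mE k : measurable (E k : set (borel Z)) by exact: measurable_cone_over.
have mUE : measurable (\bigcup_k E k : set (borel Z)).
  by apply: bigcup_measurable => k _; exact: mE.
have -> : rho @^-1` (~` [set c | (cone_rad c <= 1)%R /\
    forall k, (k.+1%:R^-1 < cone_rad c)%R -> L k (cone_base c)]) =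
    B `|` \bigcup_k E k.
  apply/seteqP; split => z /=.
    move=> /not_andP[/negP|/existsNP[k /not_implyP[kc Lc]]].
      by rewrite -ltNge; left.
    by right; exists k.
  move=> [z1 [z1' _]|[k _ [kc Lc]] [_ /(_ k kc)]//].
  by move: z1; rewrite /B /= ltNge z1'.
apply: (@le_trans _ _ (al B + al (\bigcup_k E k))); first exact: measureU2.
rewrite al1 add0e; apply: (@le_trans _ _ (\sum_(k <oo) al (E k))).
  exact: measure_sigma_subadditive.
apply: (@le_trans _ _ (\sum_(k <oo) (0 + (e / (2 ^ k.+1)%:R)%:E))).
  apply: lee_nneseries => [k _ _|k _]; first exact: measure_ge0.
  rewrite add0e; apply: le_trans (Le k).
  have k0 : (0 < k.+1%:R^-1 :> R)%R by rewrite invr_gt0.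
  have := marginal_ge (ltW k0) (mL k); rewrite -muE//.
  by rewrite lee_pdivrMl.
apply: le_trans (@epsilon_trick R (cst 0) e xpredT _ e0) _ => //.
by rewrite eseries0 ?add0e.
Qed.

(** Outer regularity of [mu] extends the inequality from open sets to Borel
    sets; applied to a set and to its complement, with equal totals, it is an
    equality. *)
Lemma marginal_eq (mu : {finite_measure set (borel X) -> \bar R}) :
  hausdorff_space X -> radon mu ->
  (forall A : set X, open A -> marg A <= mu A) -> marg setT = mu setT ->
  forall A : set (borel X), measurable A -> mu A = marg A.
Proof.
move=> hX rmu open_le eqT.
have le (A : set (borel X)) : measurable A -> marg A <= mu A.
  move=> mA; apply/lee_addgt0Pr => e e0.
  have [G [oG AG Ge]] := radon_outer hX rmu mA e0.
  apply: le_trans Ge; apply: le_trans (open_le _ oG).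
  by apply: le_marginal => //; exact: open_measurable_borel.
move=> A mA; apply/eqP; rewrite eq_le le// andbT.
have mCA : measurable (~` A) by exact: measurableC.
have muA : mu A + mu (~` A) = mu setT by rewrite -measureU ?setICr ?setUv.
have fCA := fin_num_measure mu _ mCA.
rewrite -(leeD2rE _ _ fCA) muA -eqT -(marginal_setC mA).
by rewrite leeD2l// le.
Qed.

End homogeneous_marginal.

(** * Compactness of normalized couplings *)

Lemma lsc_indic_open (R : realType) (Z : topologicalType) (G : set Z) :
  open G -> lower_semicontinuous (fun z => (\1_G z)%:E : \bar R).
Proof.
move=> oG z a az; have [a0|a0] := ltP a 0%R.
  by exists setT; [exact: filterT|move=> y _; rewrite lte_fin (lt_le_trans a0)].
have Gz : G z.
  by apply: contrapT => Gz; move: az; rewrite indicE memNset// lte_fin ltNge a0.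
exists G; first exact: open_nbhs_nbhs.
by move=> y Gy; move: az; rewrite !indicE !mem_set.
Qed.

Section minimizer.
Variables (R : realType) (X1 X2 : ptopologicalType).
Hypotheses (hX1 : hausdorff_space X1) (hX2 : hausdorff_space X2).
Local Notation fmeasure T := {finite_measure set (borel T%type) -> \bar R}.
Local Notation XX := (X1 * X2)%type.
Local Notation CC := (cone R X1 * cone R X2)%type.
Variables (mu1 : fmeasure X1) (mu2 : fmeasure X2).
Hypotheses (rmu1 : radon mu1) (rmu2 : radon mu2).

(** Each marginal is transported to a slice through the base point of the
    other space. *)
Lemma semi_coupling_exists : exists g, semi_coupling mu1 mu2 g.
Proof.
have c1 : continuous (fun x : X1 => (x, point : X2)).
  by apply: continuous_pair => x; [exact: cvg_id|exact: cvg_cst].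
have c2 : continuous (fun y : X2 => (point : X1, y)).
  by apply: continuous_pair => x; [exact: cvg_cst|exact: cvg_id].
have hXX := hausdorff_prod hX1 hX2.
have [g1 g1E] := pushforward_exists mu1 (continuous_borel_measurable c1).
have [g2 g2E] := pushforward_exists mu2 (continuous_borel_measurable c2).
exists (g1, g2); split => /=.
- apply: (radon_pushforward hX1 rmu1 hXX (continuous_borel_measurable c1)) => //.
  exact: almost_continuous_continuous.
- apply: (radon_pushforward hX2 rmu2 hXX (continuous_borel_measurable c2)) => //.
  exact: almost_continuous_continuous.
- by move=> A mA; rewrite g1E.
- by move=> A mA; rewrite g2E.
Qed.

Lemma tight_compacts (X : ptopologicalType) (mu : fmeasure X) (e : R) :
  hausdorff_space X -> radon mu -> (0 < e)%R ->
  exists L : nat -> set X, (forall k, compact (L k)) /\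
    forall k, k.+1%:R%:E * mu (~` L k) <= (e / (2 ^ k.+1)%:R)%:E.
Proof.
move=> hX rmu e0.
have e1 k : (0 < e / (2 ^ k.+1)%:R / k.+1%:R)%R.
  by rewrite !divr_gt0// ltr0n expn_gt0.
have /choice[L LP] k := radon_inner hX rmu measurableT (e1 k).
exists L; split => k; first by case: (LP k).
have [_ _] := LP k; rewrite setTD.
by rewrite -lee_pdivlMl// -EFinM mulrC.
Qed.

(** Lifts of semi-couplings have this property; it bounds the radii and makes
    the total mass equal to the sum of the two marginal masses. *)
Definition normalized (al : fmeasure CC) :=
  al [set p | cone_rad p.1 + cone_rad p.2 != 1]%R = 0.

Let M : R := fine (mu1 setT + mu2 setT).

Let ME : mu1 setT + mu2 setT = M%:E.
Proof. by rewrite /M fineK// fin_numD !fin_num_measure. Qed.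

Let hCC : hausdorff_space CC :=
  hausdorff_prod (hausdorff_cone (R := R) hX1) (hausdorff_cone (R := R) hX2).

Let c1 : continuous (@fst (cone R X1) (cone R X2)).
Proof. by move=> [x y]; exact: cvg_fst. Qed.

Let c2 : continuous (@snd (cone R X1) (cone R X2)).
Proof. by move=> [x y]; exact: cvg_snd. Qed.

Let oS : open [set p : CC | cone_rad p.1 + cone_rad p.2 != 1]%R.
Proof.
apply: (@open_comp _ _ (fun p : CC => cone_rad p.1 + cone_rad p.2)%R
    [set x | x != 1]%R) => [p _|]; last exact: open_neq.
by apply: cvgD; [exact: continuous_rad1|exact: continuous_rad2].
Qed.

Let normalized_rad_le1 (al : fmeasure CC) (rho : CC -> R) : continuous rho ->
  (forall p, (rho p <= cone_rad p.1 + cone_rad p.2)%R) -> normalized al ->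
  al [set p | (1 < rho p)%R] = 0.
Proof.
move=> crho rhole al0; apply/eqP; rewrite eq_le measure_ge0 andbT -al0.
apply: le_measure; rewrite ?inE; try exact: open_measurable_borel.
  apply: open_measurable_borel.
  by apply: (@open_comp _ _ rho [set x | (1 < x)%R]) => [z _|]; [exact: crho|exact: open_gt].
by move=> p /= p1; rewrite gt_eqF// (lt_le_trans p1).
Qed.

(** Only the marginals and the bound on the radii are used, so the same
    compact set serves all couplings. *)
Lemma normalized_couplings_tight (al : nat -> fmeasure CC) :
  (forall n, homogeneous_coupling mu1 mu2 (al n)) -> (forall n, normalized (al n)) ->
  forall e : R, (0 < e)%R ->
    exists2 K : set CC, compact K & forall n, al n (~` K) <= e%:E.
Proof.
move=> hal nal e e0; have e2 : (0 < e / 2)%R by rewrite divr_gt0.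
have [L1 [cL1 L1e]] := tight_compacts hX1 rmu1 e2.
have [L2 [cL2 L2e]] := tight_compacts hX2 rmu2 e2.
have cK1 := cone_compact (R := R) hX1 cL1.
have cK2 := cone_compact (R := R) hX2 cL2.
set K1 := [set c | _] in cK1; set K2 := [set c | _] in cK2.
exists (K1 `*` K2); first exact: compact_setX.
move=> n; have [_ _ m1 m2] := hal n.
have t1 : al n (fst @^-1` (~` K1)) <= (e / 2)%:E.
  apply: (marginal_tight c1 hX1 cL1 m1) => //; last exact: ltW.
  apply: normalized_rad_le1 => //; first exact: continuous_rad1.
  by move=> p; rewrite lerDl cone_rad_ge0.
have t2 : al n (snd @^-1` (~` K2)) <= (e / 2)%:E.
  apply: (marginal_tight c2 hX2 cL2 m2) => //; last exact: ltW.
  apply: normalized_rad_le1 => //; first exact: continuous_rad2.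
  by move=> p; rewrite lerDr cone_rad_ge0.
have mK1 : measurable (fst @^-1` (~` K1) : set (borel CC)).
  apply: (@measurable_fst_preimage (cone R X1) (cone R X2)).
  by apply: measurableC; apply: compact_measurable_borel => //; exact: hausdorff_cone.
have mK2 : measurable (snd @^-1` (~` K2) : set (borel CC)).
  apply: (@measurable_snd_preimage (cone R X1) (cone R X2)).
  by apply: measurableC; apply: compact_measurable_borel => //; exact: hausdorff_cone.
have -> : ~` (K1 `*` K2) = fst @^-1` (~` K1) `|` snd @^-1` (~` K2).
  by apply/seteqP; split => p /=; [move=> /not_andP|move=> h; apply/not_andP].
rewrite [X in X%:E]splitr EFinD; apply: le_trans (leeD t1 t2).
exact: measureU2.
Qed.

(** The limit is again normalized, since the complement of the set of radii
    with sum one is open. Its marginals are at most [mu1] and [mu2] on open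
    sets by semicontinuity, and their total masses add up to the full mass, so
    both are exact. *)
Theorem normalized_couplings_compact (al : nat -> fmeasure CC) :
  (forall n, homogeneous_coupling mu1 mu2 (al n)) -> (forall n, normalized (al n)) ->
  (forall n, al n setT = mu1 setT + mu2 setT) ->
  exists2 be, homogeneous_coupling mu1 mu2 be &
    forall (f : CC -> \bar R) (b : \bar R), (forall p, 0 <= f p) ->
      lower_semicontinuous f ->
      (\forall n \near \oo, \int[al n]_p f p <= b) -> \int[be]_p f p <= b.
Proof.
move=> hal nal alT.
have alTM n : al n setT = M%:E by rewrite alT ME.
have [be [rbe beT] bel] :=
  tight_sequence_compact hCC alTM (normalized_couplings_tight hal nal).
exists be => //.
have mS : measurable ([set p : CC | cone_rad p.1 + cone_rad p.2 != 1]%R : set (borel CC)).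
  exact: open_measurable_borel.
have be0 : normalized be.
  apply/eqP; rewrite eq_le measure_ge0 andbT -[X in be X]setIT -integral_indic//.
  apply: (bel (fun p => (\1_[set p : CC | cone_rad p.1 + cone_rad p.2 != 1]%R p)%:E)).
  - by move=> p; rewrite lee_fin.
  - exact: lsc_indic_open.
  - by near=> n; rewrite integral_indic// setIT le_eqVlt; apply/orP; left; apply/eqP; exact: nal.
have total : \int[be]_p (cone_rad p.1 + cone_rad p.2)%:E = M%:E.
  rewrite -beT -[RHS]mul1e -integral_cst//; apply: ae_eq_integral => //.
  - apply/measurable_EFinP; apply: measurable_funD.
      by apply: (@continuous_real_measurable R CC); exact: continuous_rad1.
    by apply: (@continuous_real_measurable R CC); exact: continuous_rad2.
  - have : be.-negligible [set p : CC | cone_rad p.1 + cone_rad p.2 != 1]%R.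
      by apply/negligibleP.
    apply: negligibleS => p /= h; apply/eqP => p1; apply: h => _.
    by rewrite p1.
have open1 (A : set X1) : open A -> homogeneous_marginal fst be A <= mu1 A.
  move=> oA; have mA : measurable (A : set (borel X1)) by exact: open_measurable_borel.
  rewrite -integral_marginal_integrand//; apply: bel.
  - exact: marginal_integrand_ge0.
  - exact: lsc_marginal_integrand.
  - by near=> n; rewrite integral_marginal_integrand//; have [_ _ h _] := hal n; rewrite (h A mA).
have open2 (A : set X2) : open A -> homogeneous_marginal snd be A <= mu2 A.
  move=> oA; have mA : measurable (A : set (borel X2)) by exact: open_measurable_borel.
  rewrite -integral_marginal_integrand//; apply: bel.
  - exact: marginal_integrand_ge0.
  - exact: lsc_marginal_integrand.
  - by near=> n; rewrite integral_marginal_integrand//; have [_ _ _ h] := hal n; rewrite (h A mA).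
have sumT : homogeneous_marginal fst be setT + homogeneous_marginal snd be setT =
    mu1 setT + mu2 setT.
  rewrite !marginal_setT ME -total; under [RHS]eq_integral do rewrite EFinD.
  rewrite ge0_integralD//.
  - by move=> p _; rewrite lee_fin cone_rad_ge0.
  - apply/measurable_EFinP.
    by apply: (@continuous_real_measurable R CC); exact: continuous_rad1.
  - by move=> p _; rewrite lee_fin cone_rad_ge0.
  - apply/measurable_EFinP.
    by apply: (@continuous_real_measurable R CC); exact: continuous_rad2.
have o1 := open1 _ (@openT X1); have o2 := open2 _ (@openT X2).
have f1 := fin_num_measure mu1 _ measurableT.
have f2 := fin_num_measure mu2 _ measurableT.
have eq1 : homogeneous_marginal fst be setT = mu1 setT.
  apply/eqP; rewrite eq_le o1 /= -(leeD2rE _ _ f2) -sumT leeD2l//.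
have eq2 : homogeneous_marginal snd be setT = mu2 setT.
  by apply/eqP; rewrite eq_le o2 /= -(leeD2lE _ _ f1) -sumT leeD2r.
split => //.
- by rewrite total ltry.
- by move=> A mA; apply: (marginal_eq c1 hX1 rmu1 open1 eq1 mA).
- by move=> A mA; apply: (marginal_eq c2 hX2 rmu2 open2 eq2 mA).
Unshelve. all: end_near. Qed.

End minimizer.

(** * Comparison of the two costs *)

Section equality_and_attainment.
Variables (R : realType) (X1 X2 : ptopologicalType).
Hypotheses (hX1 : hausdorff_space X1) (hX2 : hausdorff_space X2).
Local Notation fmeasure T := {finite_measure set (borel T%type) -> \bar R}.
Local Notation CC := (cone R X1 * cone R X2)%type.
Variable H : CC -> \bar R.
Hypothesis H_ge0 : forall p, 0 <= H p.
Hypothesis H_lsc : lower_semicontinuous H.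
Variables (mu1 : fmeasure X1) (mu2 : fmeasure X2).

Lemma transport_cost_le_semi :
  transport_cost H mu1 mu2 <= semi_coupling_transport_cost H mu1 mu2.
Proof.
apply/ereal_infP => _ [g sg <-].
have [al [hal _ _ alH]] := lift_semi_coupling hX1 hX2 sg.
by rewrite -alH//; apply: ereal_inf_lbound; exists al.
Qed.

Hypothesis H_hom : radially_homogeneous H.
Hypothesis H_convex : radially_convex H.

Lemma semi_le_transport_cost :
  semi_coupling_transport_cost H mu1 mu2 <= transport_cost H mu1 mu2.
Proof.
apply/ereal_infP => _ [al hal <-].
have [g sg] := project_coupling hX1 hX2 H_ge0 H_lsc H_hom H_convex hal.
by apply: le_trans; apply: ereal_inf_lbound; exists g.
Qed.

Hypotheses (rmu1 : radon mu1) (rmu2 : radon mu2).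

(** The limit of the lifts of a minimizing sequence is projected back. When
    the infimum is infinite every semi-coupling attains it. *)
Lemma semi_coupling_cost_attained :
  exists2 g, semi_coupling mu1 mu2 g &
    semi_coupling_cost H g = semi_coupling_transport_cost H mu1 mu2.
Proof.
set U := semi_coupling_transport_cost H mu1 mu2.
suff [g sg gU] : exists2 g, semi_coupling mu1 mu2 g & semi_coupling_cost H g <= U.
  exists g => //; apply/eqP; rewrite eq_le gU /=.
  by apply: ereal_inf_lbound; exists g.
have [Uoo|Ufin] := eqVneq U +oo.
  have [g sg] := semi_coupling_exists hX1 hX2 rmu1 rmu2.
  by exists g; rewrite // Uoo leey.
have U0 : 0 <= U.
  by apply/ereal_infP => _ [g _ <-]; apply: integral_ge0.
have {}Ufin : U \is a fin_num by rewrite ge0_fin_numE// ltey.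
have /choice[al alP] n : exists al : fmeasure CC,
    [/\ homogeneous_coupling mu1 mu2 al, normalized al,
        al setT = mu1 setT + mu2 setT & \int[al]_p H p <= U + n.+1%:R^-1%:E].
  have n0 : (0 < n.+1%:R^-1 :> R)%R by rewrite invr_gt0.
  have [_ [g sg <-] /ltW gU] := lb_ereal_inf_adherent n0 Ufin.
  have [al [hal alT nal alH]] := lift_semi_coupling hX1 hX2 sg.
  by exists al; split => //; rewrite alH.
have [be hbe bel] : exists2 be, homogeneous_coupling mu1 mu2 be &
    forall (f : CC -> \bar R) (b : \bar R), (forall p, 0 <= f p) ->
      lower_semicontinuous f ->
      (\forall n \near \oo, \int[al n]_p f p <= b) -> \int[be]_p f p <= b.
  by apply: (normalized_couplings_compact hX1 hX2 rmu1 rmu2) => n; case: (alP n).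
have beU : \int[be]_p H p <= U.
  apply/lee_addgt0Pr => e e0; apply: bel => //; near=> n.
  have [_ _ _ /le_trans] := alP n; apply; rewrite leeD2l// lee_fin.
  by apply: ltW; near: n; exact: (near_infty_natSinv_lt (PosNum e0)).
have [g sg gbe] := project_coupling hX1 hX2 H_ge0 H_lsc H_hom H_convex hbe.
by exists g => //; exact: le_trans beU.
Unshelve. all: end_near. Qed.

End equality_and_attainment.

Unset Implicit Arguments.

Theorem theorem11 (R : realType) (X1 X2 : ptopologicalType)
  (hX1 : hausdorff_space X1) (crX1 : completely_regular_space X1)
  (hX2 : hausdorff_space X2) (crX2 : completely_regular_space X2)
  (H : cone R X1 * cone R X2 -> \bar R)
  (H_ge0 : forall p, 0 <= H p)
  (H_proper : proper_cost H)
  (H_hom : radially_homogeneous H)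
  (H_lsc : lower_semicontinuous H)
  (mu1 : {finite_measure set (borel X1) -> \bar R})
  (mu2 : {finite_measure set (borel X2) -> \bar R})
  (radon_mu1 : radon mu1) (radon_mu2 : radon mu2)
  (mu1_gt0 : 0 < mu1 setT) (mu2_gt0 : 0 < mu2 setT) :
  transport_cost H mu1 mu2 <= semi_coupling_transport_cost H mu1 mu2 /\
  (radially_convex H ->
    transport_cost H mu1 mu2 = semi_coupling_transport_cost H mu1 mu2 /\
    exists2 g, semi_coupling mu1 mu2 g &
      semi_coupling_cost H g = semi_coupling_transport_cost H mu1 mu2).
Proof.
have le_semi := transport_cost_le_semi hX1 hX2 H_ge0 H_lsc mu1 mu2.
split => // H_convex; split; last exact: semi_coupling_cost_attained.
by apply/eqP; rewrite eq_le le_semi /=; exact: semi_le_transport_cost.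
Qed.
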